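(* Let $\bar A=(A_0,A_1)$ be a compatible couple of (quasi-)Banach spaces with $A_0\cap A_1\neq\{0\}$. Let $0<\theta_0<1$, $0<\theta\le1$, $0<q_0,r_0,r\le\infty$, $a,a_0,b_0\in SV$, and $\left\|s^{-1/r_0}\frac{b_0(s)}{a_0(s)}\right\|_{r_0,(1,\infty)}<\infty$. If $\theta=1$, assume additionally that $\left\|s^{-1/r}a(s)\right\|_{r,(0,1)}<\infty$. Put $c_0(t)=a_0(t)\left\|s^{-1/r_0}\frac{b_0(s)}{a_0(s)}\right\|_{r_0,(t,\infty)}$ and $\rho(t)=t^{1-\theta_0}c_0(t)$ for $t>0$. Then $$\left(\bar A^{\mathcal L}_{\theta_0,r_0,b_0,q_0,a_0},A_1\right)_{\theta,r,a}\cong\bar A_{\eta,r,a^{\#}},$$ where $\eta=(1-\theta)\theta_0+\theta$ and $a^{\#}(t)=c_0(t)^{1-\theta}a(\rho(t))$.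
   Context: For a compatible couple $\bar X=(X_0,X_1)$ of (quasi-)Banach spaces, $f\in X_0+X_1$ and $t>0$, $K(t,f)=K(t,f;\bar X)=\inf\{\|f_0\|_{X_0}+t\|f_1\|_{X_1}: f=f_0+f_1,\ f_i\in X_i\}$. $\|\cdot\|_{q,(c,d)}$ ($0<q\le\infty$) is the usual (quasi-)norm of the Lebesgue space $L_q$ on the interval $(c,d)$ with Lebesgue measure (variable of integration: the displayed variable; $1/\infty=0$). $SV$ is the set of positive Lebesgue measurable functions $b$ on $(0,\infty)$ that are slowly varying: for each $\varepsilon>0$, $t^{\varepsilon}b(t)$ is equivalent to an increasing function and $t^{-\varepsilon}b(t)$ is equivalent to a decreasing function, where two positive functions are equivalent if each is bounded by a constant multiple of the other. For $0\le\theta\le1$, $0<q\le\infty$, $b\in SV$, $\bar X_{\theta,q,b}=(X_0,X_1)_{\theta,q,b}$ is the space of $f\in X_0+X_1$ with $\|f\|=\left\|u^{-\theta-1/q}b(u)K(u,f)\right\|_{q,(0,\infty)}<\infty$. For $0<\sigma<1$, $0<r,q\le\infty$, $a,b\in SV$, $\bar X^{\mathcal L}_{\sigma,r,b,q,a}$ is the space of $f\in X_0+X_1$ with $\|f\|=\left\|t^{-1/r}\frac{b(t)}{a(t)}\left\|u^{-\sigma-1/q}a(u)K(u,f)\right\|_{q,(0,t)}\right\|_{r,(0,\infty)}<\infty$. $X\cong Y$ means that $X$ and $Y$ are continuously embedded in each other (same space, equivalent quasi-norms). *)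

(* Defs.v *)
From HB Require Import structures.
From mathcomp Require Import all_boot all_order all_algebra.
From mathcomp Require Import all_classical all_reals all_analysis.

Set Implicit Arguments.
Unset Strict Implicit.
Unset Printing Implicit Defensive.

Import Order.TTheory GRing.Theory Num.Theory.
Import numFieldNormedType.Exports.

Local Open Scope classical_set_scope.
Local Open Scope ring_scope.

(* A (quasi-)normed space X inside an ambient real vector space V is encoded by
   its extended quasi-norm N : V -> \bar R, with X = [set x | N x < +oo] and
   N = +oo off X.  Scalars are real: a complex space is covered by restriction
   of scalars, as no notion below except homogeneity mentions scalars. *)
Definition carrier (R : realType) (V : Type) (N : V -> \bar R) : set V :=
  [set x | (N x < +oo)%E].

(* For x off X, homogeneity reads |a| * +oo = +oo if a != 0, and it gives
   N 0 = 0 (as 0 * +oo = 0) if a = 0. *)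
Record quasi_norm (R : realType) (V : lmodType R) (N : V -> \bar R) : Prop :=
  QuasiNorm {
    quasi_norm_ge0 : forall x, (0 <= N x)%E ;
    quasi_norm0_eq0 : forall x, N x = 0%E -> x = 0 ;
    quasi_normZ : forall (a : R) x, N (a *: x) = (`|a|%:E * N x)%E ;
    quasi_normD : exists2 C : R, 1 <= C &
      forall x y, (N (x + y)%R <= C%:E * (N x + N y))%E }.

Definition quasi_complete (R : realType) (V : lmodType R) (N : V -> \bar R) :=
  forall u : nat -> V,
    (forall n, carrier N (u n)) ->
    (forall e : R, 0 < e ->
       exists n0, forall m n, (n0 <= m)%N -> (n0 <= n)%N ->
         (N (u m - u n)%R < e%:E)%E) ->
    exists2 l, carrier N l & (N (u n - l)) @[n --> \oo] --> (0 : \bar R)%E.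

Definition quasi_Banach (R : realType) (V : lmodType R) (N : V -> \bar R) :=
  quasi_norm N /\ quasi_complete N.

(* The inclusion X -> V is continuous (at 0, hence everywhere). *)
Definition continuously_included (R : realType) (V : topologicalLmodType R)
    (N : V -> \bar R) :=
  forall U : set V, nbhs (0 : V) U ->
    exists2 d : R, 0 < d & forall x, (N x < d%:E)%E -> U x.

Record compatible_couple (R : realType) (V : topologicalLmodType R)
    (N0 N1 : V -> \bar R) : Prop := CompatibleCouple {
  couple_hausdorff : hausdorff_space V ;
  couple_Banach0 : quasi_Banach N0 ;
  couple_Banach1 : quasi_Banach N1 ;
  couple_included0 : continuously_included N0 ;
  couple_included1 : continuously_included N1 }.

Definition sum_space (R : realType) (V : lmodType R) (N0 N1 : V -> \bar R) :
    set V :=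
  [set f | exists f0 f1, [/\ carrier N0 f0, carrier N1 f1 & f = f0 + f1]].

(* K(t, f; X0, X1); it is +oo off X0 + X1, as an infimum over the empty set. *)
Definition Kfun (R : realType) (V : lmodType R) (N0 N1 : V -> \bar R)
    (t : R) (f : V) : \bar R :=
  ereal_inf [set x | exists f0 f1,
    [/\ carrier N0 f0, carrier N1 f1, f = f0 + f1
      & x = (N0 f0 + t%:E * N1 f1)%E]].

(* The quasi-norm of L_q(D), by extension by 0 off D.  The library's Lebesgue
   measure lives on the Borel sigma-algebra; its integral of a nonnegative
   function is a supremum over Borel simple functions below it, and its
   essential supremum ignores all subsets of Borel null sets, so both have
   their usual values on Lebesgue measurable functions too. *)
Definition Lq_norm (R : realType) (q : \bar R) (D : set R) (g : R -> \bar R) :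
    \bar R :=
  Lnorm (@lebesgue_measure R) q (g \_ D).

(* 1/q, with 1/oo = 0. *)
Definition rinv (R : realType) (q : \bar R) : R := fine (q^-1)%E.

(* Measurability for the completed (Caratheodory) sigma-algebra. *)
Definition Lebesgue_measurable_fun (R : realType) (D : set R) (b : R -> R) :=
  @measurable_fun _ _
    (caratheodory_type ((@wlength R idfun)^*)%mu) (measurableTypeR R) D b.

Definition equivalent (R : realType) (f g : R -> R) :=
  exists2 C : R, 0 < C &
    forall t, 0 < t -> f t <= C * g t /\ g t <= C * f t.

(* Only the values on ]0, +oo[ matter. *)
Record slowly_varying (R : realType) (b : R -> R) : Prop := SlowlyVarying {
  sv_gt0 : forall t, 0 < t -> 0 < b t ;
  sv_measurable : Lebesgue_measurable_fun `]0, +oo[ b ;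
  sv_increasing : forall e, 0 < e -> exists g : R -> R,
    [/\ (forall t, 0 < t -> 0 < g t),
        (forall s t, 0 < s -> s <= t -> g s <= g t)
      & equivalent (fun t => t `^ e * b t) g] ;
  sv_decreasing : forall e, 0 < e -> exists g : R -> R,
    [/\ (forall t, 0 < t -> 0 < g t),
        (forall s t, 0 < s -> s <= t -> g t <= g s)
      & equivalent (fun t => t `^ (- e) * b t) g] }.

(* The quasi-norm of (X0, X1)_{theta, q, b}. *)
Definition interp_norm (R : realType) (V : lmodType R) (N0 N1 : V -> \bar R)
    (theta : R) (q : \bar R) (b : R -> R) (f : V) : \bar R :=
  if `[< sum_space N0 N1 f >] then
    Lq_norm q `]0, +oo[
      (fun u => (u `^ (- theta - rinv q) * b u)%:E * Kfun N0 N1 u f)%E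
  else +oo%E.

(* The quasi-norm of (X0, X1)^L_{sigma, r, b, q, a}. *)
Definition interpL_norm (R : realType) (V : lmodType R) (N0 N1 : V -> \bar R)
    (sigma : R) (r : \bar R) (b : R -> R) (q : \bar R) (a : R -> R) (f : V) :
    \bar R :=
  if `[< sum_space N0 N1 f >] then
    Lq_norm r `]0, +oo[
      (fun t => (t `^ (- rinv r) * (b t / a t))%:E *
         Lq_norm q `]0%R, t[
           (fun u => (u `^ (- sigma - rinv q) * a u)%:E * Kfun N0 N1 u f))%E
  else +oo%E.

Definition embedded (R : realType) (V : Type) (N M : V -> \bar R) :=
  carrier N `<=` carrier M /\
  exists2 C : R, 0 < C & forall f, carrier N f -> (M f <= C%:E * N f)%E.

Definition isomorphic_spaces (R : realType) (V : Type) (N M : V -> \bar R) :=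
  embedded N M /\ embedded M N.

(* Main.v *)
Require Import Defs.
From HB Require Import structures.
From mathcomp Require Import all_boot all_order all_algebra.
From mathcomp Require Import all_classical all_reals all_analysis.
From mathcomp Require Import measurable_realfun ess_sup_inf.
From mathcomp Require Import zify ring lra.

(* Write X for the space on the left of the couple (X, A1), K and Kbar for the
   K-functionals of (A0, A1) and (X, A1), and G(t) = rho(t) K(t, f) / t.  A full
   Holmstedt formula for Kbar is not needed, only the sandwich
     c G(t) <= Kbar(rho(t), f) <= C sup_(u <= t) (t / u)^delta G(u)
   for some small delta > 0.  The left inequality restricts the X-norm to s > t
   and u close to t; the right one comes from a nearly optimal decomposition
   for K(t, f), since the X-norm of its first term is then the norm of an
   explicit function.  As ln rho is within a bounded distance of a function
   that is bi-Lipschitz in ln t, rho has a quasi-inverse, and a single Schur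
   test over grids of ratio e^L performs the change of variable v = rho(t) and
   absorbs the supremum.
   Every function involved changes by a bounded factor when its argument does,
   so its norm is comparable to a sum over a grid; this makes the measurability
   of a, a0, b0 irrelevant. *)

Set Implicit Arguments.
Unset Strict Implicit.
Unset Printing Implicit Defensive.

Import Order.TTheory GRing.Theory Num.Theory.
Import numFieldNormedType.Exports.

Local Open Scope classical_set_scope.
Local Open Scope ring_scope.

(** An exact formula for [Kbar] would involve a nested norm of [K] restricted to [u < t], to be
    removed afterwards by Hardy inequalities. The supremum weighted by [(t / u)^delta] is cruder but
    pointwise, and it gives the first term of a decomposition an explicit profile on both sides of
    [t]. The loss of [delta] is affordable because [theta > 0]: on both sides of the equivalence [G]
    carries the weight [rho^(- theta) * a(rho)], which decays in [t] at least like a fixed negative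
    power, up to a constant. Half of this guaranteed decay absorbs the supremum, so [delta] is a
    fixed fraction of [theta * (1 - theta0)]. Slow variation enters through logarithms only, as a
    Lipschitz bound of arbitrarily small slope up to an additive constant. Each use spends a
    fraction of some available power, which explains the many halves among the constants. *)

(** * Lower integrals of nonnegative functions *)

Section lower_integral.
Context d (T : measurableType d) (R : realType).
Variable mu : {measure set T -> \bar R}.
Local Open Scope ereal_scope.
Implicit Types f g : T -> \bar R.

Import HBNNSimple.

(* On a non-measurable function the library's integral is the lower integral,
   which is still monotone, homogeneous, and subadditive in the domain. *)
Lemma le_integral_nnsfun f y : (forall x, 0 <= f x) ->
  (forall h : {nnsfun T >-> R}, (forall x, (h x)%:E <= f x) ->
     \int[mu]_x (h x)%:E <= y) ->
  \int[mu]_x f x <= y.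
Proof.
move=> f0 hy; rewrite ge0_integralTE//; apply/ge_ereal_sup => _ [h hf <-].
rewrite (_ : sintegral mu h = \int[mu]_x (h x)%:E) ?hy//.
by rewrite integral_nnsfun//; congr sintegral; rewrite patch_setT.
Qed.

Lemma nnsfun_le_integral f (h : {nnsfun T >-> R}) : (forall x, 0 <= f x) ->
  (forall x, (h x)%:E <= f x) -> \int[mu]_x (h x)%:E <= \int[mu]_x f x.
Proof.
move=> f0 hf; rewrite (ge0_integralTE mu f0); apply: ereal_sup_ubound; exists h => //.
by rewrite integral_nnsfun//; congr sintegral; rewrite patch_setT.
Qed.

Lemma le_lower_integral f g : (forall x, 0 <= f x) -> (forall x, f x <= g x) ->
  \int[mu]_x f x <= \int[mu]_x g x.
Proof.
move=> f0 fg; apply: le_integral_nnsfun => // h hf.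
by apply: nnsfun_le_integral => x; [exact: le_trans (fg x)|exact: le_trans (fg x)].
Qed.

Lemma le_lower_integralZ (c : R) f : (0 < c)%R -> (forall x, 0 <= f x) ->
  \int[mu]_x (c%:E * f x) <= c%:E * \int[mu]_x f x.
Proof.
move=> c0 f0; apply: le_integral_nnsfun => [x|h hf].
  by rewrite mule_ge0// lee_fin ltW.
have ci0 : (0 <= c^-1)%R by rewrite invr_ge0 ltW.
have -> : \int[mu]_x (h x)%:E = c%:E * \int[mu]_x (scale_nnsfun h ci0 x)%:E.
  rewrite -ge0_integralZl_EFin//=; last 3 first.
  - by move=> x _; rewrite lee_fin mulr_ge0// fun_ge0.
  - by apply/measurable_EFinP; exact/measurable_funM.
  - exact: ltW.
  by apply: eq_integral => x _; rewrite -EFinM mulrA divff ?mul1r// gt_eqF.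
apply: lee_wpmul2l; first by rewrite lee_fin ltW.
apply: nnsfun_le_integral => // x /=.
by rewrite EFinM muleC lee_pdivrMr// muleC.
Qed.

(** A simple function below [f] on the union is at most the sum of its restrictions to [A] and [B],
    and these remain simple because the two sets are measurable. *)
Lemma le_lower_integralU (A B : set T) f : measurable A -> measurable B ->
  (forall x, 0 <= f x) ->
  \int[mu]_x (f \_ (A `|` B)) x <= \int[mu]_x (f \_ A) x + \int[mu]_x (f \_ B) x.
Proof.
move=> mA mB f0; have fD D x : 0 <= (f \_ D) x by exact: erestrict_ge0.
apply: le_integral_nnsfun => // h hf.
pose hA := proj_nnsfun h mA; pose hB := proj_nnsfun h mB.
have hD (D : set T) (mD : measurable D) x :
    (D `<=` A `|` B) -> (proj_nnsfun h mD x)%:E <= (f \_ D) x.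
  move=> DAB; rewrite /= mindicE /patch; case: ifPn => [xD|].
    rewrite mulr1; have := hf x; rewrite /patch mem_set//.
    by apply: DAB; exact/set_mem.
  by rewrite mulr0.
apply: (@le_trans _ _ (\int[mu]_x (hA x)%:E + \int[mu]_x (hB x)%:E)); last first.
  by apply: leeD; apply: nnsfun_le_integral => // x; apply: hD => ? ?;
    [left|right].
rewrite -ge0_integralD//; last 4 first.
- by move=> x _; rewrite lee_fin fun_ge0.
- exact/measurable_EFinP.
- by move=> x _; rewrite lee_fin fun_ge0.
- exact/measurable_EFinP.
apply: le_lower_integral => x; first by rewrite lee_fin fun_ge0.
rewrite -EFinD lee_fin /= !mindicE.
have := hf x; rewrite /patch in_setU; have h0 : (0 <= h x)%R by exact: fun_ge0.
case: (x \in A); case: (x \in B); rewrite /= ?lee_fin /=; lra.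
Qed.

End lower_integral.

(** * Quasi-norms of L_q for all exponents *)

Section Lq_norm_lemmas.
Context (R : realType).
Local Open Scope ereal_scope.
Implicit Types (q : \bar R) (A B D : set R) (g : R -> \bar R).

Local Notation mu := (@lebesgue_measure R).

Lemma Lq_norm_ge0 q D g : 0 <= Lq_norm q D g.
Proof. exact: Lnorm_ge0. Qed.

Lemma Lq_norm_real (p : R) D g : (forall x, D x -> 0 <= g x) ->
  Lq_norm p%:E D g = (\int[mu]_x ((g \_ D) x `^ p)) `^ p^-1.
Proof.
move=> g0; rewrite /Lq_norm unlock; congr (_ `^ _); apply: eq_integral => x _.
by rewrite gee0_abs// erestrict_ge0.
Qed.

Lemma lebesgue_measureT_gt0 : 0 < mu [set: R].
Proof. by rewrite -set_itvE lebesgue_measure_itv/= ?ltry. Qed.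

Lemma Lq_norm_oo D g : (forall x, D x -> 0 <= g x) ->
  Lq_norm +oo D g = ess_sup mu (g \_ D).
Proof.
move=> g0; rewrite /Lq_norm unlock lebesgue_measureT_gt0.
by congr ess_sup; apply/funext => x /=; rewrite gee0_abs// erestrict_ge0.
Qed.

Lemma Lq_norm_leZ q D (c : R) g h : 0 < q -> (0 < c)%R ->
  (forall x, D x -> 0 <= g x) -> (forall x, D x -> g x <= c%:E * h x) ->
  Lq_norm q D g <= c%:E * Lq_norm q D h.
Proof.
move=> q0 c0 g0 gh.
have h0 x : D x -> 0 <= h x.
  move=> Dx; have := le_trans (g0 x Dx) (gh x Dx).
  by rewrite pmule_rge0// lte_fin.
have ghD x : (g \_ D) x <= c%:E * (h \_ D) x.
  rewrite /patch; case: ifPn => [xD|]; last by rewrite mule0.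
  by apply: gh; exact/set_mem.
have gD0 x : 0 <= (g \_ D) x by exact: erestrict_ge0.
have hD0 x : 0 <= (h \_ D) x by exact: erestrict_ge0.
case: q q0 => [p|_|//]; last first.
  rewrite !Lq_norm_oo// -ess_sup_pZl//; apply: le_ess_sup.
  by apply: nearW.
rewrite lte_fin => p0; rewrite !Lq_norm_real//.
have pi0 : (0 < p^-1)%R by rewrite invr_gt0.
have cp0 : (0 < c `^ p)%R by exact: powR_gt0.
rewrite -(_ : ((c `^ p)%:E * \int[mu]_x ((h \_ D) x `^ p)) `^ p^-1 =
              c%:E * (\int[mu]_x ((h \_ D) x `^ p)) `^ p^-1); last first.
  rewrite poweRM ?integral_ge0//; last 2 first.
  - by rewrite lee_fin ltW.
  - by move=> x _; exact: poweR_ge0.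
  by rewrite poweR_EFin -powRrM divff ?gt_eqF// powRr1// ltW.
have pos x : 0 <= (g \_ D) x `^ p by exact: poweR_ge0.
apply: gt0_ler_poweR; first exact: ltW.
- by rewrite in_itv/= leey andbT integral_ge0.
- rewrite in_itv/= leey andbT mule_ge0 ?lee_fin ?(ltW cp0)// integral_ge0// => x _.
  exact: poweR_ge0.
apply: (@le_trans _ _ (\int[mu]_x ((c `^ p)%:E * (h \_ D) x `^ p))); last first.
  by apply: le_lower_integralZ => // x; exact: poweR_ge0.
apply: le_lower_integral => // x.
rewrite -poweR_EFin -poweRM//; last by rewrite lee_fin ltW.
apply: gt0_ler_poweR => //; first exact: ltW.
- by rewrite in_itv/= leey andbT.
- by rewrite in_itv/= leey andbT mule_ge0// lee_fin ltW.
Qed.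

Lemma le_Lq_norm q D g h : 0 < q ->
  (forall x, D x -> 0 <= g x) -> (forall x, D x -> g x <= h x) ->
  Lq_norm q D g <= Lq_norm q D h.
Proof.
move=> q0 g0 gh; rewrite -[leRHS]mul1e.
by apply: Lq_norm_leZ => // x Dx; rewrite mul1e gh.
Qed.

Lemma eq_Lq_norm q D g h : (forall x, D x -> g x = h x) ->
  Lq_norm q D g = Lq_norm q D h.
Proof.
move=> gh; rewrite /Lq_norm; congr Lnorm; apply/funext => x; rewrite /patch.
by case: ifPn => // /set_mem/gh.
Qed.

Lemma sub_Lq_norm q A B g : 0 < q -> A `<=` B ->
  (forall x, B x -> 0 <= g x) -> Lq_norm q A g <= Lq_norm q B g.
Proof.
move=> q0 AB g0.
rewrite (_ : Lq_norm q A g = Lq_norm q B (g \_ A)); last first.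
  rewrite /Lq_norm; congr (Lnorm _ _ _); apply/funext => x; rewrite /patch.
  case: ifPn => [/set_mem/AB xB|_]; first by rewrite mem_set.
  by case: ifP.
apply: le_Lq_norm => // x Bx; rewrite /patch; case: ifPn => // xA; exact: g0.
Qed.

Lemma Lq_norm_setU q : 0 < q -> exists2 C : R, (0 < C)%R &
  forall A B g, measurable A -> measurable B ->
    (forall x, (A `|` B) x -> 0 <= g x) ->
    Lq_norm q (A `|` B) g <= C%:E * (Lq_norm q A g + Lq_norm q B g).
Proof.
case: q => [p|_|//]; last first.
  exists 1%R => // A B g _ _ g0; rewrite mul1e.
  have gA0 x : A x -> 0 <= g x by move=> Ax; apply: g0; left.
  have gB0 x : B x -> 0 <= g x by move=> Bx; apply: g0; right.
  rewrite !Lq_norm_oo//.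
  have nA x : 0 <= (g \_ A) x by apply: erestrict_ge0 => y Ay; apply: g0; left.
  have nB x : 0 <= (g \_ B) x by apply: erestrict_ge0 => y By; apply: g0; right.
  apply/ess_supP.
  have := ess_sup_ge mu (g \_ A); have := ess_sup_ge mu (g \_ B).
  apply: filterS2 => x gB gA; apply: le_trans (leeD gA gB).
  have := nB x; rewrite /patch in_setU.
  by case: (x \in A) => /= ?; rewrite ?add0e// leeDl.
rewrite lte_fin => p0; exists (2 `^ p^-1)%R; first by rewrite powR_gt0.
move=> A B g mA mB g0.
have nA x : 0 <= (g \_ A) x by apply: erestrict_ge0 => y Ay; apply: g0; left.
have nB x : 0 <= (g \_ B) x by apply: erestrict_ge0 => y By; apply: g0; right.
have nU x : 0 <= (g \_ (A `|` B)) x by exact: erestrict_ge0.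
have gA0 x : A x -> 0 <= g x by move=> Ax; apply: g0; left.
have gB0 x : B x -> 0 <= g x by move=> Bx; apply: g0; right.
rewrite !Lq_norm_real//.
have patchp D x : (fun y => g y `^ p) \_ D = (fun y => (g \_ D) y `^ p).
  apply/funext => y; rewrite /patch; case: ifP => // _; rewrite poweR0r//.
  by rewrite gt_eqF.
set IA := \int[mu]_x ((g \_ A) x `^ p); set IB := \int[mu]_x ((g \_ B) x `^ p).
have IA0 : 0 <= IA by apply: integral_ge0 => x _; exact: poweR_ge0.
have IB0 : 0 <= IB by apply: integral_ge0 => x _; exact: poweR_ge0.
have pi0 : (0 <= p^-1)%R by rewrite invr_ge0 ltW.
have mono x y : 0 <= x -> x <= y -> x `^ p^-1 <= y `^ p^-1.
  move=> x0 xy; apply: gt0_ler_poweR => //; rewrite in_itv/= leey andbT//.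
  exact: le_trans xy.
have IU : \int[mu]_x ((g \_ (A `|` B)) x `^ p) <= IA + IB.
  have gp0 x : 0 <= (fun y => (g \_ (A `|` B)) y `^ p) x by exact: poweR_ge0.
  have := le_lower_integralU mu mA mB gp0.
  have E D : D `<=` A `|` B ->
      (fun y => (g \_ (A `|` B)) y `^ p) \_ D = (fun y => (g \_ D) y `^ p).
    move=> DAB; apply/funext => y; rewrite /patch; case: ifPn => yD.
      by rewrite mem_set//; apply: DAB; exact/set_mem.
    by rewrite poweR0r// gt_eqF.
  by rewrite !E//; exact: subsetUl || exact: subsetUr.
apply: le_trans (mono _ _ _ IU) _.
  by apply: integral_ge0 => x _; exact: poweR_ge0.
have dbl x y : 0 <= x -> 0 <= y -> x <= y ->
    (x + y) `^ p^-1 <= (2 `^ p^-1)%:E * (x `^ p^-1 + y `^ p^-1).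
  move=> x0 y0 xy; apply: (@le_trans _ _ ((2%:E * y) `^ p^-1)).
    apply: mono; first exact: adde_ge0.
    by rewrite mule_natl mule2n leeD.
  rewrite poweRM// poweR_EFin; apply: lee_wpmul2l; first by rewrite lee_fin powR_ge0.
  by rewrite leeDr// poweR_ge0.
have [AB|/ltW BA] := leP IA IB; first exact: dbl.
by rewrite addeC [leRHS](_ : _ = (2 `^ p^-1)%:E * (IB `^ p^-1 + IA `^ p^-1)) ?dbl// addeC.
Qed.

Lemma Lq_norm_cst_itv q (x y c : R) : 0 < q -> (x < y)%R -> (0 <= c)%R ->
  Lq_norm q `]x, y[%classic (fun=> c%:E) = (c * (y - x) `^ rinv q)%:E.
Proof.
move=> q0 xy c0.
have c0' : forall z, `]x, y[%classic z -> 0 <= c%:E by move=> *; rewrite lee_fin.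
have mxy : mu `]x, y[%classic = (y - x)%:E.
  by rewrite lebesgue_measure_itv/= lte_fin xy.
case: q q0 => [p|_|//].
  rewrite lte_fin => p0; rewrite Lq_norm_real//.
  rewrite [X in X `^ _](_ : _ = ((c `^ p) * (y - x))%:E).
    rewrite poweR_EFin powRM ?powR_ge0 ?subr_ge0 ?(ltW xy)//.
    rewrite -powRrM divff ?gt_eqF// powRr1// /rinv.
    by rewrite inver gt_eqF.
  transitivity (\int[mu]_(z in `]x, y[%classic) (c `^ p)%:E).
    rewrite [RHS]integral_mkcond; apply: eq_integral => z _; rewrite /patch.
    by case: ifP => // _; rewrite poweR0r// gt_eqF.
  by rewrite integral_cst//= mxy.
rewrite Lq_norm_oo// /rinv/= powRr0 mulr1.
apply/eqP; rewrite eq_le; apply/andP; split.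
  apply/ess_supP; apply: nearW => z; rewrite /patch; case: ifP => // _.
(* Were the essential supremum below [c], the whole interval, of positive measure, would lie in a
   null set. *)
rewrite leNgt; apply/negP => ec.
have [N [mN N0 xyN]] := ess_sup_ge mu ((fun=> c%:E) \_ `]x, y[%classic).
have : (y - x)%:E <= 0.
  rewrite -mxy -N0; apply: le_measure; rewrite ?inE//.
  apply: subset_trans xyN => z xyz /=; rewrite {1}/patch mem_set//.
  by apply/negP; rewrite -ltNge.
by rewrite lee_fin leNgt subr_gt0 xy.
Qed.

End Lq_norm_lemmas.

(** * Sums over the integers and exponential kernels *)

Section sums_over_int.
Context (R : realType).

(** The enumeration 0, -1, 1, -2, ..., which turns sums over [int] into series over [nat]. *)
Definition int_of_index (n : nat) : int := if odd n then Negz n./2 else Posz n./2.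

Lemma int_of_index_bij : bijective int_of_index.
Proof.
exists (fun k : int => match k with Posz m => m.*2 | Negz m => m.*2.+1 end).
  move=> n; rewrite /int_of_index.
  by case: ifP => on; rewrite -[RHS](odd_double_half n) on.
by case=> n; rewrite /int_of_index/= odd_double/= ?uphalf_double ?doubleK.
Qed.

Lemma esum_int (a : int -> \bar R) : (forall k, (0 <= a k)%E) ->
  (\esum_(k in [set: int]) a k = \sum_(n <oo) a (int_of_index n))%E.
Proof.
move=> a0; rewrite nneseries_esumT//; apply: reindex_esum.
by rewrite setTT_bijective; exact: int_of_index_bij.
Qed.

Lemma esum_intZ (c : R) (a : int -> \bar R) : 0 <= c -> (forall k, (0 <= a k)%E) ->
  (\esum_(k in [set: int]) (c%:E * a k) = c%:E * \esum_(k in [set: int]) a k)%E.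
Proof.
move=> c0 a0; rewrite !esum_int ?nneseriesZl//; first by move=> k; rewrite mule_ge0.
Qed.

Lemma esum_le_inj (f : int -> int) (a : int -> \bar R) : injective f ->
  (forall k, (0 <= a k)%E) ->
  (\esum_(k in [set: int]) a (f k) <= \esum_(k in [set: int]) a k)%E.
Proof.
move=> finj a0; rewrite -(@esum_image R _ _ setT f a); last first.
  by move=> x y _ _; exact: finj.
by rewrite esum_mkcond; apply: le_esum => i _; case: ifP.
Qed.

(** The [n]-th integer of the enumeration has absolute value at least [(n - 1) / 2], so a geometric
    series of ratio [expR (- s / 2)] dominates. *)
Lemma esum_expR_lty (s : R) : 0 < s ->
  (\esum_(k in [set: int]) (expR (- s * `|k%:~R|))%:E < +oo)%E.
Proof.
move=> s0; rewrite esum_int; last by move=> k; rewrite lee_fin expR_ge0.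
pose z := expR (- s / 2).
have z1 : `|z| < 1.
  by rewrite ger0_norm ?expR_ge0// /z expR_lt1; lra.
have zp : 0 < z by exact: expR_gt0.
apply: (@le_lt_trans _ _ (expR (s / 2) * (1 - z)^-1)%:E); last exact: ltry.
apply: lime_le.
  by apply: is_cvg_nneseries => n _ _; rewrite lee_fin expR_ge0.
apply: nearW => n; rewrite sumEFin lee_fin.
apply: le_trans (geometric_le_lim n (expR_ge0 (s / 2)) zp z1).
rewrite /series/=; apply: ler_sum => i _.
rewrite /z -expRM_natr -expRD ler_expR.
have : (i%:R - 1) / 2 <= `|(int_of_index i)%:~R| :> R.
  rewrite /int_of_index -{1}(odd_double_half i) natrD -muln2 natrM.
  have h0 : 0 <= i./2%:R :> R by exact: ler0n.
  case: ifP => _.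
    rewrite NegzE mulrNz normrN -pmulrn ger0_norm ?ler0n// -(natr1 i./2) /=; lra.
  rewrite -pmulrn ger0_norm ?ler0n//=; lra.
nra.
Qed.

Lemma intr_dist_ge1 (i j : int) : i != j -> 1 <= `|i%:~R - j%:~R| :> R.
Proof. by move=> ij; rewrite -intrB -intr_norm -[1]/(1%:~R) ler_int; lia. Qed.

(** Points at mutual distance at least 1 have distinct integer parts; subtracting the integer part
    of [x] injects them into the integers and changes distances to [x] by at most 1. The Schur test
    relies on [Z] being uniform in [phi] and [x]. *)
Lemma separated_esum (s : R) : 0 < s -> exists2 Z : R, 0 < Z &
  forall (phi : int -> R) (x : R),
    (forall i j, i != j -> 1 <= `|phi i - phi j|) ->
  (\esum_(j in [set: int]) (expR (- s * `|phi j - x|))%:E <= Z%:E)%E.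
Proof.
move=> s0; have := esum_expR_lty s0.
set S := esum _ _ => Slty.
have S0 : (0 <= S)%E by apply: esum_ge0 => k _; rewrite lee_fin expR_ge0.
have Sfin : S \is a fin_num by rewrite ge0_fin_numE.
(* [expR s] pays for the rounding of the distances; the 1 makes the constant positive without a
   lower bound on [S]. *)
exists (expR s * (fine S + 1)) => [|phi x sep].
  by rewrite mulr_gt0 ?expR_gt0// ltr_wpDl// fine_ge0.
pose m j := Num.floor (phi j) - Num.floor x.
have minj : injective m.
  move=> i j /addIr fij; apply/eqP/negP => /negP/sep.
  have := floor_itv (phi i); have := floor_itv (phi j).
  rewrite fij => /andP[+ +] /andP[+ +].
  rewrite intrD /= => h1 h2 h3 h4; rewrite leNgt => /negP; apply.
  by rewrite ltr_norml; apply/andP; split; lra.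
apply: (@le_trans _ _ ((expR s)%:E * S)%E); last first.
  rewrite EFinM EFinD fineK// lee_pmul2l// ?lte_fin ?expR_gt0//.
  by rewrite leeDl.
apply: (@le_trans _ _ ((expR s)%:E * \esum_(j in [set: int])
    (expR (- s * `|(m j)%:~R|))%:E)%E); last first.
  apply: lee_wpmul2l; first by rewrite lee_fin expR_ge0.
  apply: (@esum_le_inj m (fun k => (expR (- s * `|k%:~R|))%:E)).
    exact: minj.
  by move=> k; rewrite lee_fin expR_ge0.
rewrite -esum_intZ ?expR_ge0//.
apply: le_esum => j _; rewrite -EFinM lee_fin -expRD ler_expR.
have : `|(m j)%:~R| <= `|phi j - x| + 1 :> R.
  have := floor_itv (phi j); have := floor_itv x.
  rewrite /m intrB !intrD => /andP[h1 h2] /andP[h3 h4].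
  have := ler_norm (phi j - x); have := ler_norm (- (phi j - x)).
  rewrite normrN => h5 h6; rewrite ler_norml; apply/andP; split; lra.
nra.
Qed.

End sums_over_int.

(** * Geometric grids on the half-line *)

Section geometric_grid.
Context (R : realType).
Variables (L : R) (L0 : 0 < L).

Definition node (k : int) : R := expR (L * k%:~R).
Definition cell (k : int) : set R := `[node k, node (k + 1)[%classic.
Definition cell_index (u : R) : int := Num.floor (ln u / L).

Lemma node_gt0 k : 0 < node k. Proof. exact: expR_gt0. Qed.

Lemma ln_node k : ln (node k) = L * k%:~R. Proof. exact: expRK. Qed.

Lemma node_succ k : node (k + 1) = node k * expR L.
Proof. by rewrite /node intrD mulrDr mulr1 expRD. Qed.

Lemma cell_gt0 k u : cell k u -> 0 < u.
Proof. by rewrite /cell/= in_itv/= => /andP[+ _]; apply: lt_le_trans; exact: node_gt0. Qed.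

Lemma cellP k u : 0 < u -> cell k u <-> cell_index u = k.
Proof.
move=> u0; have mem : cell k u = (k%:~R <= ln u / L < (k + 1)%:~R) :> Prop.
  rewrite /cell/= in_itv/= -(lnK u0) /node !(ler_expR, ltr_expR).
  by rewrite expRK ler_pdivlMr// ltr_pdivrMr// ![L * _]mulrC.
rewrite mem; split => [/floor_def//|<-]; exact: floor_itv.
Qed.

Lemma cell_cell_index u : 0 < u -> cell (cell_index u) u.
Proof. by move=> u0; apply/cellP. Qed.

Lemma measurable_cell k : measurable (cell k). Proof. exact: measurable_itv. Qed.

Lemma bigcup_cell : \bigcup_n cell (int_of_index n) = `]0, +oo[%classic.
Proof.
apply/seteqP; split => u /=.
  by case=> n _ /cell_gt0 u0; rewrite in_itv/= u0.
rewrite in_itv/= andbT => u0; have [g _ gK] := int_of_index_bij.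
by exists (g (cell_index u)) => //; rewrite gK; exact: cell_cell_index.
Qed.

Lemma trivIset_cell : trivIset setT (fun n => cell (int_of_index n)).
Proof.
move=> i j _ _ [u [ui uj]]; have u0 := cell_gt0 ui.
apply: (bij_inj int_of_index_bij).
by rewrite -(proj1 (cellP _ u0) ui) -(proj1 (cellP _ u0) uj).
Qed.

(** Cell [k] has length [(expR L - 1) * node L k]; division by the node therefore gives all cells
    the same mass, as for the measure du/u. *)
Lemma integral_grid (y : int -> R) : (forall k, 0 <= y k) ->
  (\int[@lebesgue_measure R]_(u in `]0%R, +oo[%classic)
      (y (cell_index u) / node (cell_index u))%:E =
   (expR L - 1)%:E * \esum_(k in [set: int]) (y k)%:E)%E.
Proof.
move=> y0; set f := (X in integral _ _ X).
have fE k u : cell k u -> f u = (y k / node k)%:E.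
  by move=> uk; rewrite /f (proj1 (cellP _ (cell_gt0 uk)) uk).
have f0 u : (0 <= f u)%E by rewrite lee_fin divr_ge0// ltW// node_gt0.
rewrite -bigcup_cell ge0_integral_bigcup//; first last.
- exact: trivIset_cell.
- by move=> u _; exact: f0.
- apply/measurable_fun_bigcup => [n|n]; first exact: measurable_cell.
  apply: (@eq_measurable_fun _ _ _ _ _
    (cst (y (int_of_index n) / node (int_of_index n))%:E)) => //.
  by move=> u /set_mem/fE.
- by move=> n; exact: measurable_cell.
have y0' k : (0 <= (y k)%:E)%E by rewrite lee_fin.
rewrite -esum_intZ//; last by rewrite subr_ge0 ltW// expR_gt1.
rewrite esum_int; last first.
  by move=> k; rewrite -EFinM lee_fin mulr_ge0// subr_ge0 ltW// expR_gt1.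
apply: eq_eseriesr => n _; set k := int_of_index n.
rewrite (eq_integral (fun=> (y k / node k)%:E)); last first.
  by move=> u /set_mem /fE.
rewrite integral_cst//=; last exact: measurable_cell.
rewrite /cell [X in (_ * X)%E]lebesgue_measure_itv/= lte_fin node_succ.
have nk := node_gt0 k; rewrite ltr_pMr// expR_gt1 L0 -!EFinM; congr EFin.
by field; rewrite gt_eqF.
Qed.

End geometric_grid.

(** * Moderate functions, their Haar norms and discretization *)

Section moderate_functions.
Context (R : realType).
Implicit Types (h x y : R -> R) (q : \bar R).

(* Power growth in both directions: expR `|ln u - ln t| = max(u / t, t / u). *)
Definition moderate (p C : R) h :=
  (forall t, 0 < t -> 0 <= h t) /\
  forall u t, 0 < u -> 0 < t -> h u <= C * expR (p * `|ln u - ln t|) * h t.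

Lemma powR_expR (u s : R) : 0 < u -> u `^ s = expR (s * ln u).
Proof. by move=> u0; rewrite /powR gt_eqF. Qed.

Lemma rinv_real (r : R) : 0 < r -> rinv r%:E = r^-1.
Proof. by move=> r0; rewrite /rinv inver gt_eqF. Qed.

Lemma rinv_oo : rinv (+oo : \bar R) = 0. Proof. by []. Qed.

Lemma rinv_ge0 q : (0 < q)%E -> 0 <= rinv q.
Proof.
case: q => [r|_|//]; last by rewrite rinv_oo.
by rewrite lte_fin => r0; rewrite rinv_real// invr_ge0 ltW.
Qed.

(* The norm of h in L_q of the Haar measure du/u. *)
Definition haar_norm q h : \bar R :=
  Lq_norm q `]0%R, +oo[%classic (fun u => (u `^ (- rinv q) * h u)%:E).

Lemma pos_itvP (u : R) : `]0%R, +oo[%classic u -> 0 < u.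
Proof. by rewrite /= in_itv/= andbT. Qed.

Definition grid_sum (L r : R) h : \bar R :=
  (\esum_(k in [set: int]) (h (node L k) `^ r)%:E)%E.

Section discretization.
Variables (r p C L : R) (r0 : 0 < r) (p0 : 0 <= p) (C0 : 0 < C) (L0 : 0 < L).

(** Constant on cells, hence with an explicit norm, and comparable to the integrand of [haar_norm]
    whenever [h] is moderate. *)
Let step h u := node L (cell_index L u) `^ (- r^-1) * h (node L (cell_index L u)).

Let step_norm h : (forall t, 0 < t -> 0 <= h t) ->
  Lq_norm r%:E `]0%R, +oo[%classic (EFin \o step h) =
  (((expR L - 1) `^ r^-1)%:E * (grid_sum L r h `^ r^-1))%E.
Proof.
move=> h0; have step0 u : 0 <= step h u.
  by rewrite mulr_ge0 ?powR_ge0// h0// node_gt0.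
rewrite Lq_norm_real; last by move=> u _; rewrite lee_fin.
rewrite -poweR_EFin -poweRM; last 2 first.
- by rewrite lee_fin subr_ge0 ltW// expR_gt1.
- by apply: esum_ge0 => k _; rewrite lee_fin powR_ge0.
congr poweR; rewrite -integral_grid//; last by move=> k; exact: powR_ge0.
rewrite [RHS]integral_mkcond; apply: eq_integral => u _; rewrite /patch.
case: ifP => // _; last by rewrite poweR0r// gt_eqF.
rewrite /= /step; have n0 := node_gt0 L (cell_index L u).
rewrite powRM ?powR_ge0 ?h0// -powRrM mulNr mulVf ?gt_eqF// powR_inv1 ?ltW//.
by rewrite mulrC.
Qed.

Let in_cell u : 0 < u -> 0 <= ln u - ln (node L (cell_index L u)) <= L.
Proof.
move=> u0; have := cell_cell_index L0 u0; rewrite /cell/= in_itv/= node_succ.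
set n := node L _; have n0 : 0 < n by exact: node_gt0.
case/andP => nu un; rewrite subr_ge0 ler_ln// nu /= lerBlDl.
rewrite -[X in _ + X](expRK L) -lnM ?posrE ?expR_gt0// ler_ln ?posrE// ?ltW//.
by rewrite mulr_gt0// expR_gt0.
Qed.

Lemma haar_norm_le_sum : exists2 A : R, 0 < A & forall h, moderate p C h ->
  (haar_norm r%:E h <= A%:E * (grid_sum L r h `^ r^-1))%E.
Proof.
exists (C * expR (p * L) * (expR L - 1) `^ r^-1).
  by rewrite !mulr_gt0 ?expR_gt0// powR_gt0// subr_gt0 expR_gt1.
move=> h [h0 hC]; rewrite EFinM -muleA -step_norm//.
apply: Lq_norm_leZ; rewrite ?lte_fin//.
- by rewrite mulr_gt0// expR_gt0.
- by move=> u /pos_itvP u0; rewrite lee_fin mulr_ge0 ?powR_ge0 ?h0.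
move=> u /pos_itvP u0; rewrite -EFinM lee_fin /step.
have /andP[d0 dL] := in_cell u0; set n := node L _ in d0 dL *.
have n0 : 0 < n by exact: node_gt0.
rewrite mulrCA; apply: ler_pM; rewrite ?powR_ge0 ?h0//.
  rewrite rinv_real// !powR_expR// ler_expR !mulNr lerN2 ler_pM2l ?invr_gt0//.
  by rewrite -subr_ge0.
apply: le_trans (hC _ _ u0 n0) _; apply: ler_wpM2r; first exact: h0.
by rewrite ler_pM2l// ler_expR ger0_norm// ler_wpM2l.
Qed.

Lemma sum_le_haar_norm : exists2 A : R, 0 < A & forall h, moderate p C h ->
  (grid_sum L r h `^ r^-1 <= A%:E * haar_norm r%:E h)%E.
Proof.
pose B := (expR L - 1) `^ r^-1.
have B0 : 0 < B by rewrite powR_gt0// subr_gt0 expR_gt1.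
(* The decreasing weight is larger at the node than at [u], by a factor of at most
   [expR (r^-1 * L)]; in the opposite comparison this factor was at most 1. *)
pose D := expR (r^-1 * L) * (C * expR (p * L)).
have D0 : 0 < D by rewrite !mulr_gt0 ?expR_gt0.
exists (B^-1 * D); first by rewrite mulr_gt0 ?invr_gt0.
move=> h [h0 hC]; rewrite EFinM -muleA lee_pdivlMl// -step_norm//.
apply: Lq_norm_leZ; rewrite ?lte_fin//.
  by move=> u _; rewrite lee_fin mulr_ge0 ?powR_ge0// h0// node_gt0.
move=> u /pos_itvP u0; rewrite -EFinM lee_fin /step.
have /andP[d0 dL] := in_cell u0; set n := node L _ in d0 dL *.
have n0 : 0 < n by exact: node_gt0.
rewrite /D mulrACA; apply: ler_pM; rewrite ?powR_ge0 ?h0//.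
  rewrite rinv_real// !powR_expR// -expRD ler_expR !mulNr.
  by rewrite -mulrBr -mulrN ler_pM2l ?invr_gt0//; lra.
apply: le_trans (hC _ _ n0 u0) _; apply: ler_wpM2r; first exact: h0.
by rewrite ler_pM2l// ler_expR distrC ger0_norm// ler_wpM2l.
Qed.

End discretization.

Lemma haar_norm_oo_le h (D : R) : 0 <= D -> (forall t, 0 < t -> 0 <= h t <= D) ->
  (haar_norm +oo h <= D%:E)%E.
Proof.
move=> D0 hD; rewrite /haar_norm Lq_norm_oo; last first.
  by move=> u /pos_itvP/hD/andP[h0 _]; rewrite lee_fin mulr_ge0 ?powR_ge0.
apply/ess_supP; apply: nearW => u; rewrite /patch; case: ifPn => [|_].
  by move=> /set_mem/pos_itvP/hD/andP[_ h1]; rewrite rinv_oo oppr0 powRr0 mul1r lee_fin.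
by rewrite lee_fin.
Qed.

(** On an interval of logarithmic length 1 adjacent to or around [t], [h] is comparable to [h t], so
    the norm over that interval already dominates [h t]. The position of [s] stays free because the
    interval lies to the right of [t] for tails and to its left for the inner norm of [X]. *)
Lemma moderate_le_Lq_norm q p C : (0 < q)%E -> 0 <= p -> 0 < C ->
  exists2 A : R, 0 < A & forall h, moderate p C h ->
  forall s t (D : set R), 0 < s -> s <= t <= expR 1 * s ->
    `]s, expR 1 * s[%classic `<=` D -> (forall u, D u -> 0 < u) ->
    ((h t)%:E <= A%:E * Lq_norm q D (fun u => (u `^ (- rinv q) * h u)%:E))%E.
Proof.
move=> q0 p0 C0; have e1 : 1 < expR 1 :> R by rewrite expR_gt1.
have e0 : 0 < expR 1 - 1 :> R by rewrite subr_gt0.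
pose B : R := (expR 1 - 1) `^ rinv q; have B0 : 0 < B by exact: powR_gt0.
pose D0 : R := expR (rinv q) * (C * expR p).
have D00 : 0 < D0 by rewrite !mulr_gt0 ?expR_gt0.
exists (B^-1 * D0); first by rewrite mulr_gt0 ?invr_gt0.
move=> h [h0 hC] s t D s0 /andP[st ts] sD Dpos.
have t0 : 0 < t by exact: lt_le_trans st.
have ses : s < expR 1 * s by rewrite ltr_pMl.
(* This constant has norm [B * h t] over []s, expR 1 * s[]: the length is [(expR 1 - 1) * s], and
   the powers of [s] cancel. *)
have cpos : 0 <= h t * s `^ (- rinv q) by rewrite mulr_ge0 ?h0 ?powR_ge0.
have := Lq_norm_cst_itv q0 ses cpos.
rewrite (_ : expR 1 * s - s = (expR 1 - 1) * s); last by ring.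
rewrite (powRM _ (ltW e0) (ltW s0)) -/B (_ : _ * (B * _) = B * h t); last first.
  rewrite powRN; field; first exact: lt0r_neq0 (powR_gt0 _ s0).
move=> E; rewrite EFinM -muleA lee_pdivlMl// -EFinM -E.
have Dh u : D u -> (0 <= (u `^ (- rinv q) * h u)%:E)%E.
  by move=> /Dpos u0; rewrite lee_fin mulr_ge0 ?powR_ge0 ?h0.
have := sub_Lq_norm q0 sD Dh; rewrite -(@lee_pmul2l _ D0%:E) ?lte_fin//.
apply: le_trans; apply: Lq_norm_leZ => // u.
rewrite /= in_itv/= => /andP[su us]; have u0 := lt_trans s0 su.
have lnes : ln (expR 1 * s) = 1 + ln s by rewrite lnM ?posrE ?expR_gt0// expRK.
have es0 : 0 < expR 1 * s by rewrite mulr_gt0// expR_gt0.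
have h1 : ln s <= ln u by rewrite ler_ln ?posrE// ltW.
have h2 : ln u <= 1 + ln s by rewrite -lnes ler_ln ?posrE// ltW.
have h3 : ln s <= ln t by rewrite ler_ln ?posrE.
have h4 : ln t <= 1 + ln s by rewrite -lnes ler_ln ?posrE.
rewrite -EFinM lee_fin mulrC /D0 mulrACA; apply: ler_pM; rewrite ?powR_ge0 ?h0//.
  rewrite !powR_expR// -expRD ler_expR; have := rinv_ge0 q0; nra.
apply: le_trans (hC _ _ t0 u0) _; apply: ler_wpM2r; first exact: h0.
rewrite ler_pM2l// ler_expR ler_piMr// ler_norml; apply/andP; split; lra.
Qed.

Lemma moderate_le_haar_norm q p C : (0 < q)%E -> 0 <= p -> 0 < C ->
  exists2 A : R, 0 < A & forall h, moderate p C h ->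
  forall t, 0 < t -> ((h t)%:E <= A%:E * haar_norm q h)%E.
Proof.
move=> q0 p0 C0; have [A A0 HA] := moderate_le_Lq_norm q0 p0 C0.
exists A => // h hm t t0; apply: (HA _ hm t) => //.
- by rewrite lexx /= ler_peMl ?ltW// expR_gt1.
- by move=> u /=; rewrite !in_itv/= => /andP[/(lt_trans t0)->].
- by move=> u /pos_itvP.
Qed.

(** The measure du/u is invariant under dilation, so the centre [c] cannot matter; on the grid this
    is the uniform bound for separated points. It stands in for all explicit integrals of powers
    below. *)
Lemma haar_norm_kernel q (e : R) : (0 < q)%E -> 0 < e ->
  exists2 Z : R, 0 < Z & forall c : R,
    (haar_norm q (fun u => expR (- e * `|ln u - c|)%R) <= Z%:E)%E.
Proof.
move=> q0 e0; have km c : moderate e 1 (fun u => expR (- e * `|ln u - c|)).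
  split => [t _|u t _ _]; first exact: expR_ge0.
  rewrite mul1r -expRD ler_expR.
  suff : `|ln t - c| <= `|ln u - ln t| + `|ln u - c| by nra.
  rewrite [X in _ <= X + _]distrC; apply: le_trans (ler_normD _ _).
  by rewrite addrA subrK.
case: q q0 => [r| |//]; last first.
  move=> _; exists 1 => // c; apply: haar_norm_oo_le => // t _.
  by rewrite expR_ge0 expR_le1 mulNr oppr_le0 mulr_ge0// ltW.
rewrite lte_fin => r0.
have [A A0 HA] := haar_norm_le_sum r0 (ltW e0) (ltr01 : 0 < 1 :> R) (ltr01 : 0 < 1 :> R).
have [Z Z0 HZ] := separated_esum (mulr_gt0 e0 r0).
exists (A * Z `^ r^-1); first by rewrite mulr_gt0// powR_gt0.
move=> c; apply: le_trans (HA _ (km c)) _.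
rewrite EFinM lee_pmul2l ?lte_fin// -poweR_EFin.
apply: gt0_ler_poweR; first by rewrite invr_ge0 ltW.
- by rewrite in_itv/= leey andbT esum_ge0// => k _; rewrite lee_fin powR_ge0.
- by rewrite in_itv/= leey andbT lee_fin ltW.
apply: le_trans (HZ intr c (@intr_dist_ge1 R)); apply: le_esum => k _.
by rewrite lee_fin ln_node mul1r -expRM (mulrAC (- e)) mulNr.
Qed.

End moderate_functions.

(** * A Schur test for all exponents *)

Section schur_test.
Context (R : realType).
Implicit Types (x y psi : R -> R) (q : \bar R).

Lemma esum_int_exchange (a : int -> int -> \bar R) : (forall i j, (0 <= a i j)%E) ->
  (\esum_(i in [set: int]) \esum_(j in [set: int]) a i j =
   \esum_(j in [set: int]) \esum_(i in [set: int]) a i j)%E.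
Proof.
move=> a0; rewrite !esum_int; try by move=> k; exact: esum_ge0.
under eq_eseriesr do rewrite esum_int//.
rewrite nneseries_interchange//; apply: eq_eseriesr => n _.
by rewrite esum_int.
Qed.

(* y v <= C * sup_u x u * exp(- lam * |psi v - ln u|), without the supremum. *)
Definition schur_dominated (lam C : R) psi x y := forall v, 0 < v ->
  forall D, 0 < D ->
    (forall u, 0 < u -> x u <= D * expR (lam * `|psi v - ln u|)) -> y v <= C * D.

(** The norms that serve as [D] may vanish, whereas the decompositions behind the domination are
    produced for positive [D]; a limit bridges the gap. *)
Lemma schur_dominated_ge0 lam C psi x y v D : 0 < C ->
  schur_dominated lam C psi x y -> 0 < v -> 0 <= D ->
  (forall u, 0 < u -> x u <= D * expR (lam * `|psi v - ln u|)) -> y v <= C * D.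
Proof.
move=> C0 xy v0 D0 xD; apply/ler_addgt0Pr => e e0.
rewrite (_ : C * D + e = C * (D + e / C)); last by field; rewrite gt_eqF.
have eC : 0 < e / C by rewrite divr_gt0.
apply: xy => //; first by rewrite ltr_wpDl.
move=> u u0; apply: le_trans (xD u u0) _.
by rewrite ler_wpM2r ?expR_ge0// lerDl ltW.
Qed.

(** A supremum is at most an l^r sum, so [y]^ r[at a node is bounded by a sum of values of]x [^ r]
    against an exponential kernel. This takes no convexity and covers [r < 1]. Once the sums are
    exchanged, only the sums of the kernel over [j] remain, and these are bounded because [psi]
    separates the nodes. *)
Lemma haar_norm_schur q (lam kap c p C : R) : (0 < q)%E -> 0 < lam -> 0 < kap ->
  0 <= c -> 0 <= p -> 0 < C ->
  exists2 A : R, 0 < A & forall x y psi, moderate p C x -> moderate p C y ->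
    (forall v w, 0 < v -> 0 < w ->
       kap * `|ln v - ln w| - c <= `|psi v - psi w|) ->
    schur_dominated lam C psi x y ->
    (haar_norm q y <= A%:E * haar_norm q x)%E.
Proof.
move=> q0 lam0 kap0 c0 p0 C0.
case: q q0 => [r| |//]; last first.
  move=> q0; have [A A0 HA] := moderate_le_haar_norm q0 p0 C0.
  exists (C * A) => [|x y psi xm ym _ xy]; first exact: mulr_gt0.
  have := Lq_norm_ge0 +oo `]0%R, +oo[%classic (fun u => (u `^ (- rinv +oo) * x u)%:E).
  rewrite -/(haar_norm +oo x); case E : (haar_norm +oo x) => [n| |]// n0; last first.
    by rewrite mulry gtr0_sg ?mulr_gt0// mul1e leey.
  rewrite -EFinM; apply: haar_norm_oo_le => [|t t0].
    by rewrite !mulr_ge0// ltW.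
  rewrite ym.1//= -mulrA.
  apply: schur_dominated_ge0 xy t0 _ _; rewrite ?mulr_ge0 ?(ltW A0)// => u u0.
  have := HA _ xm u u0; rewrite E -EFinM lee_fin => /le_trans; apply.
  rewrite ler_peMr ?mulr_ge0 ?(ltW A0)//.
  by rewrite -expR0 ler_expR mulr_ge0// ltW.
rewrite lte_fin => r0.
(* With this ratio [psi] maps distinct nodes to points at distance at least [kap * L - c = 1]. *)
pose L := (1 + c) / kap.
have L0 : 0 < L by rewrite divr_gt0// ltr_wpDr.
have [A1 A10 HA1] := haar_norm_le_sum r0 p0 C0 L0.
have [A2 A20 HA2] := sum_le_haar_norm r0 p0 C0 (ltr01 : 0 < 1 :> R).
have [Z Z0 HZ] := separated_esum (mulr_gt0 lam0 r0).
(* The price of moving from [u] to the node of its unit cell: [C * expR p] in [x], [expR lam] in the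
   kernel. *)
pose D' := C * expR p * expR lam; have D'0 : 0 < D' by rewrite !mulr_gt0 ?expR_gt0.
pose M := (C * D') `^ r; have M0 : 0 < M by rewrite powR_gt0// mulr_gt0.
exists (A1 * ((M * Z) `^ r^-1 * A2)).
  by rewrite !mulr_gt0// powR_gt0// mulr_gt0.
move=> x y psi xm ym psiE xy.
apply: le_trans (HA1 _ ym) _; rewrite EFinM -muleA lee_pmul2l ?lte_fin//.
have gs_ge0 L' h : (0 <= grid_sum L' r h)%E.
  by apply: esum_ge0 => k _; rewrite lee_fin powR_ge0.
have ri0 : 0 <= r^-1 by rewrite invr_ge0 ltW.
suff H : (grid_sum L r y <= (M * Z)%:E * grid_sum 1 r x)%E.
  apply: (@le_trans _ _ (((M * Z)%:E * grid_sum 1 r x) `^ r^-1)%E).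
    apply: gt0_ler_poweR => //; rewrite in_itv/= leey andbT//.
    by rewrite mule_ge0// lee_fin mulr_ge0// ltW.
  rewrite poweRM//; last by rewrite lee_fin mulr_ge0// ltW.
  rewrite [in leRHS]EFinM -muleA -poweR_EFin; apply: lee_wpmul2l; last exact: HA2.
  by rewrite poweR_ge0.
pose psi_ j := psi (node L j).
pose K i j := expR (- (lam * r) * `|psi_ j - i%:~R|).
pose T j := (\esum_(i in [set: int]) ((K i j)%:E * (x (node 1 i) `^ r)%:E))%E.
have n0 L' k : 0 < node L' k :> R by exact: node_gt0.
have yT j : ((y (node L j) `^ r)%:E <= M%:E * T j)%E.
  have T0 : (0 <= T j)%E.
    by apply: esum_ge0 => i _; rewrite mule_ge0 ?lee_fin ?powR_ge0 ?expR_ge0.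
  case E : (T j) => [tau| |]; last 2 first.
  - by rewrite mulry gtr0_sg// mul1e leey.
  - by move: T0; rewrite E.
  have tau0 : 0 <= tau by move: T0; rewrite E lee_fin.
  rewrite -EFinM lee_fin.
  (* Each single term of the sum is at most [tau]; solving for [x] gives the hypothesis of the
     domination at the nodes. *)
  have xi i : x (node 1 i) <= tau `^ r^-1 * expR (lam * `|psi_ j - i%:~R|).
    have : ((K i j)%:E * (x (node 1 i) `^ r)%:E <= T j)%E.
      by apply: esum_ge; exists [set i]; [split|rewrite fsbig_set1].
    rewrite E -EFinM lee_fin => h.
    have x0 : 0 <= x (node 1 i) by exact: xm.1.
    have : (K i j * x (node 1 i) `^ r) `^ r^-1 <= tau `^ r^-1.
      by apply: ge0_ler_powR => //; rewrite nnegrE// mulr_ge0 ?expR_ge0 ?powR_ge0.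
    rewrite powRM ?expR_ge0 ?powR_ge0// -powRrM divff ?gt_eqF// powRr1//.
    rewrite /K -expRM -ler_pdivlMl ?expR_gt0// -expRN mulrC => /le_trans; apply.
    rewrite ler_wpM2l ?powR_ge0// ler_expR le_eqVlt; apply/orP; left; apply/eqP.
    by field; rewrite gt_eqF.
  rewrite (_ : M * tau = (C * (D' * tau `^ r^-1)) `^ r); last first.
    rewrite mulrA powRM ?powR_ge0 ?mulr_ge0 ?(ltW C0) ?(ltW D'0)//.
    by rewrite -powRrM mulVf ?gt_eqF// powRr1.
  apply: ge0_ler_powR; rewrite ?nnegrE ?(ltW r0)//.
  - exact: ym.1.
  - by rewrite !mulr_ge0 ?powR_ge0 ?(ltW C0) ?(ltW D'0).
  apply: schur_dominated_ge0 xy _ _ _ => //.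
    by rewrite mulr_ge0 ?powR_ge0 ?(ltW D'0).
  move=> u u0; pose i := cell_index 1 u.
  have /andP[d0 d1] : i%:~R <= ln u <= i%:~R + 1.
    have := floor_itv (ln u / 1); rewrite -/(cell_index 1 u) -/i divr1 intrD.
    by case/andP => -> /ltW.
  apply: le_trans (xm.2 _ _ u0 (n0 1 i)) _; rewrite ln_node mul1r.
  apply: (@le_trans _ _ (C * expR p * (tau `^ r^-1 * expR (lam * `|psi_ j - i%:~R|)))).
    apply: ler_pM => //.
    - by rewrite mulr_ge0 ?expR_ge0// ltW.
    - exact: xm.1.
    - rewrite ler_pM2l// ler_expR ler_piMr// ler_norml; apply/andP; split; lra.
  rewrite /D' [leRHS](_ : _ = C * expR p * (tau `^ r^-1 *
      (expR lam * expR (lam * `|psi (node L j) - ln u|)))); last by ring.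
  rewrite ler_wpM2l ?mulr_ge0 ?expR_ge0 ?(ltW C0)//.
  rewrite ler_wpM2l ?powR_ge0// -expRD ler_expR -/(psi_ j).
  suff : `|psi_ j - i%:~R| <= 1 + `|psi_ j - ln u| by nra.
  have -> : psi_ j - i%:~R = (ln u - i%:~R) + (psi_ j - ln u) by ring.
  apply: le_trans (ler_normD _ _) _; rewrite lerD2r ler_norml; apply/andP; split; lra.
have K0 i j : (0 <= (K i j)%:E)%E by rewrite lee_fin expR_ge0.
have X0 i : (0 <= (x (node 1 i) `^ r)%:E)%E by rewrite lee_fin powR_ge0.
apply: (@le_trans _ _ (\esum_(j in [set: int]) (M%:E * T j))%E).
  by apply: le_esum => j _; exact: yT.
rewrite esum_intZ ?(ltW M0)//; last by move=> j; apply: esum_ge0 => i _; rewrite mule_ge0.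
rewrite EFinM -muleA lee_pmul2l ?lte_fin// /T esum_int_exchange; last first.
  by move=> i j; rewrite mule_ge0.
rewrite /grid_sum -esum_intZ ?(ltW Z0)//; apply: le_esum => i _.
under eq_esum do rewrite muleC.
rewrite esum_intZ ?powR_ge0// muleC lee_wpmul2r//; apply: HZ => a b ab.
have := psiE _ _ (n0 L a) (n0 L b); apply: le_trans.
rewrite !ln_node -mulrBr normrM gtr0_norm// mulrA.
rewrite (_ : kap * L = 1 + c); last by rewrite /L; field; rewrite gt_eqF.
have := intr_dist_ge1 R ab; nra.
Qed.

End schur_test.

(** * Slow variation in logarithmic form, and tails *)

Section log_slow.
Context (R : realType).
Implicit Types (b w : R -> R) (q : \bar R).

(* Slow variation without monotone equivalents: ln b is e-Lipschitz in ln t, up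
   to an additive constant, for every e > 0. *)
Definition log_slow b := (forall t, 0 < t -> 0 < b t) /\
  forall e, 0 < e -> exists2 C, 0 <= C &
    forall u t, 0 < u -> 0 < t ->
      `|ln (b u) - ln (b t)| <= e * `|ln u - ln t| + C.

Lemma log_slow_sub b : (forall t, 0 < t -> 0 < b t) ->
  (forall e, 0 < e -> exists C, forall u t, 0 < u -> u <= t ->
      `|ln (b u) - ln (b t)| <= e * (ln t - ln u) + C) ->
  log_slow b.
Proof.
move=> b0 H; split=> // e e0; have [C HC] := H e e0.
exists `|C| => // u t u0 t0; have [ut|tu] := leP u t.
  have ln_ut : ln u <= ln t by rewrite ler_ln ?posrE.
  have -> : `|ln u - ln t| = ln t - ln u by rewrite distrC ger0_norm// subr_ge0.
  have := HC u t u0 ut; have := ler_norm C; lra.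
have ln_tu : ln t <= ln u by rewrite ler_ln ?posrE// ltW.
have -> : `|ln u - ln t| = ln u - ln t by rewrite ger0_norm// subr_ge0.
have := HC t u t0 (ltW tu); have := ler_norm C; rewrite distrC; lra.
Qed.

(** For [u <= t] the increasing equivalent bounds [ln (b u) - ln (b t)] from above and the
    decreasing one from below. Each equivalence is crossed twice, hence [2 * ln C] and
    [2 * ln D]. *)
Lemma slowly_varying_log_slow b : slowly_varying b -> log_slow b.
Proof.
move=> sb; have b0 := sv_gt0 sb; apply: log_slow_sub => // e e0.
have [g [g0 gmon [C C0 HC]]] := sv_increasing sb e0.
have [h [h0 hmon [D D0 HD]]] := sv_decreasing sb e0.
exists (`|2 * ln C| + `|2 * ln D|) => u t u0 ut; have t0 := lt_le_trans u0 ut.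
have bu := b0 u u0; have bt := b0 t t0.
have i1 : u `^ e * b u <= C * (C * (t `^ e * b t)).
  apply: le_trans (HC u u0).1 _; rewrite ler_pM2l//.
  by apply: le_trans (gmon u t u0 ut) _; exact: (HC t t0).2.
have i2 : t `^ (- e) * b t <= D * (D * (u `^ (- e) * b u)).
  apply: le_trans (HD t t0).1 _; rewrite ler_pM2l//.
  by apply: le_trans (hmon u t u0 ut) _; exact: (HD u u0).2.
have ln2 (c x y : R) : 0 < c -> 0 < x -> 0 < y -> x <= c * (c * y) ->
    ln x <= 2 * ln c + ln y.
  move=> c0 x0 y0; rewrite -ler_ln ?posrE ?mulr_gt0// !lnM ?posrE ?mulr_gt0//; lra.
have p (s v : R) : 0 < v -> 0 < v `^ s by move=> v0; exact: powR_gt0.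
have := ln2 _ _ _ C0 (mulr_gt0 (p e u u0) bu) (mulr_gt0 (p e t t0) bt) i1.
have := ln2 _ _ _ D0 (mulr_gt0 (p (- e) t t0) bt) (mulr_gt0 (p (- e) u u0) bu) i2.
rewrite !lnM ?posrE ?p//.
rewrite !ln_powR => j2 j1; have := ler_norm (2 * ln C); have := ler_norm (2 * ln D).
have := normr_ge0 (2 * ln C); have := normr_ge0 (2 * ln D).
rewrite ler_norml => *; apply/andP; split; lra.
Qed.

Lemma log_slowM b w : log_slow b -> log_slow w -> log_slow (fun t => b t * w t).
Proof.
move=> [b0 Hb] [w0 Hw]; split=> [t t0|e e0]; first by rewrite mulr_gt0 ?b0 ?w0.
have e2 : 0 < e / 2 by rewrite divr_gt0.
have [C C0 HC] := Hb _ e2; have [D D0 HD] := Hw _ e2.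
exists (C + D) => [|u t u0 t0]; first exact: addr_ge0.
rewrite !lnM ?posrE ?b0 ?w0//.
rewrite (_ : _ - _ = (ln (b u) - ln (b t)) + (ln (w u) - ln (w t))); last by ring.
apply: le_trans (ler_normD _ _) _; have := HC u t u0 t0; have := HD u t u0 t0; lra.
Qed.

Lemma log_slowV b : log_slow b -> log_slow (fun t => (b t)^-1).
Proof.
move=> [b0 Hb]; split=> [t t0|e e0]; first by rewrite invr_gt0 b0.
have [C C0 HC] := Hb e e0; exists C => // u t u0 t0.
by rewrite !lnV ?posrE ?b0// opprK addrC distrC HC.
Qed.

Lemma log_slow_moderate b e : log_slow b -> 0 < e ->
  exists2 C : R, 0 < C & moderate e C b.
Proof.
move=> [b0 Hb] e0; have [C C0 HC] := Hb e e0.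
exists (expR C); first exact: expR_gt0.
split=> [t t0|u t u0 t0]; first exact/ltW/b0.
rewrite -(lnK (b0 u u0)) -(lnK (b0 t t0)) -!expRD ler_expR.
have := ler_norm (ln (b u) - ln (b t)); have := HC u t u0 t0; lra.
Qed.

Definition tail_norm q w t := Lq_norm q `]t, +oo[%classic
  (fun s => (s `^ (- rinv q) * w s)%:E).

Lemma itv_pos (t u : R) : 0 < t -> `]t, +oo[%classic u -> 0 < u.
Proof. by move=> t0 /=; rewrite in_itv/= andbT; exact: lt_trans. Qed.

Lemma weight_ge0 q w D : log_slow w -> (forall u, D u -> 0 < u) ->
  forall u, D u -> (0 <= (u `^ (- rinv q) * w u)%:E)%E.
Proof.
by move=> [w0 _] D0 u /D0 u0; rewrite lee_fin mulr_ge0 ?powR_ge0// ltW// w0.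
Qed.

Lemma le_tail_norm q w : (0 < q)%E -> log_slow w -> exists2 A : R, 0 < A &
  forall t, 0 < t -> ((w t)%:E <= A%:E * tail_norm q w t)%E.
Proof.
move=> q0 sw; have [C C0 wm] := log_slow_moderate sw (ltr01 : 0 < 1 :> R).
have [A A0 HA] := moderate_le_Lq_norm q0 (ler01 : 0 <= 1 :> R) C0.
exists A => // t t0; apply: (HA _ wm t) => //.
- by rewrite lexx /= ler_peMl ?ltW// expR_gt1.
- by move=> u /=; rewrite !in_itv/= => /andP[->].
- by move=> u; exact: itv_pos.
Qed.

Lemma tail_norm_anti q w u t : (0 < q)%E -> log_slow w -> 0 < u -> u <= t ->
  (tail_norm q w t <= tail_norm q w u)%E.
Proof.
move=> q0 sw u0 ut; apply: sub_Lq_norm => //; last first.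
  by apply: weight_ge0 => // s; exact: itv_pos.
by move=> s /=; rewrite !in_itv/= !andbT; exact: le_lt_trans.
Qed.

(** On []u, t]] slow variation gives [w s <= C * E * expR (- e * (ln s - ln u)) * w t], with [E] the
    factor of the claim. The exponential has bounded norm, and [w t] is dominated by the tail at
    [t]. *)
Lemma tail_norm_growth q w e : (0 < q)%E -> log_slow w -> 0 < e ->
  exists2 A : R, 0 < A & forall u t, 0 < u -> u <= t ->
   (tail_norm q w u <= (A * expR (e * (ln t - ln u)))%:E * tail_norm q w t)%E.
Proof.
move=> q0 sw e0; have [C C0 [_ HC]] := log_slow_moderate sw e0.
have [B B0 HB] := le_tail_norm q0 sw; have [D D0 HD] := Lq_norm_setU q0.
have [Z Z0 HZ] := haar_norm_kernel q0 e0.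
exists (D * (C * B * Z + 1)); first by rewrite mulr_gt0// addr_gt0// !mulr_gt0.
move=> u t u0 ut; have t0 := lt_le_trans u0 ut.
have lnut : 0 <= ln t - ln u by rewrite subr_ge0 ler_ln ?posrE.
set E := expR _; have E1 : 1 <= E by rewrite -expR0 ler_expR mulr_ge0// ltW.
have sw0 s : 0 < s -> 0 < w s by exact: sw.1.
have T0 : (0 <= tail_norm q w t)%E by exact: Lq_norm_ge0.
have -> : tail_norm q w u = Lq_norm q (`]u, t]%classic `|` `]t, +oo[%classic)
    (fun s => (s `^ (- rinv q) * w s)%:E).
  rewrite /tail_norm; congr Lq_norm; apply/seteqP; split=> s /=.
    by rewrite !in_itv/= !andbT => us; case: (leP s t); [left; rewrite us|right].
  by rewrite !in_itv/= !andbT => -[/andP[]//|]; exact: le_lt_trans.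
apply: (@le_trans _ _ _ _ _ (HD _ _ _ _ _ _)) => //.
  move=> s [|] /=; rewrite in_itv/=.
    by move=> /andP[us _]; rewrite lee_fin mulr_ge0 ?powR_ge0// ltW// sw0// (lt_trans u0).
  by rewrite andbT => ts; rewrite lee_fin mulr_ge0 ?powR_ge0// ltW// sw0// (lt_trans t0).
rewrite -mulrA EFinM -muleA lee_pmul2l ?lte_fin// mulrDl mul1r.
have E0 : 0 <= E by exact: expR_ge0.
have CE0 : 0 <= C * B * Z * E by rewrite !mulr_ge0 ?(ltW C0) ?(ltW B0) ?(ltW Z0).
rewrite EFinD ge0_muleDl ?lee_fin//.
apply: leeD; last first.
  by rewrite -[leLHS]mul1e; apply: lee_wpmul2r; rewrite ?lee_fin.
rewrite (_ : C * B * Z * E = (C * E * Z) * B); last by ring.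
rewrite EFinM -muleA.
apply: (@le_trans _ _ ((C * E * Z)%:E * (w t)%:E)%E); last first.
  by apply: lee_wpmul2l; [rewrite lee_fin !mulr_ge0 ?ltW// (lt_le_trans ltr01)|exact: HB].
have CEw : 0 < C * E * w t by rewrite !mulr_gt0 ?sw0// expR_gt0.
rewrite -EFinM mulrAC EFinM; apply: (@le_trans _ _ ((C * E * w t)%:E *
    Lq_norm q `]u, t]%classic
      (fun s : R => (s `^ (- rinv q) * expR (- e * `|ln s - ln u|))%R%:E))%E).
  apply: Lq_norm_leZ => // [s|s]; rewrite /= in_itv/= => /andP[us st].
    by rewrite lee_fin mulr_ge0 ?powR_ge0// ltW// sw0// (lt_trans u0).
  have s0 := lt_trans u0 us.
  rewrite -EFinM lee_fin mulrCA ler_wpM2l ?powR_ge0//.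
  apply: le_trans (HC s t s0 t0) _; rewrite -!mulrA ler_pM2l// mulrA.
  rewrite [leRHS]mulrAC ler_pM2r ?sw0// /E -expRD ler_expR.
  have h1 : ln u <= ln s by rewrite ler_ln ?posrE// ltW.
  have h2 : ln s <= ln t by rewrite ler_ln ?posrE.
  rewrite distrC !ger0_norm ?subr_ge0//; lra.
apply: lee_wpmul2l; first by rewrite lee_fin ltW.
apply: le_trans (HZ (ln u)); apply: sub_Lq_norm => //.
  by move=> s /=; rewrite !in_itv/= => /andP[/(lt_trans u0)->].
by move=> s _; rewrite lee_fin mulr_ge0 ?powR_ge0 ?expR_ge0.
Qed.

(** The growth bound carries finiteness from 1 down to smaller [t]; together with monotonicity it is
    slow variation of the tail. *)
Lemma tail_norm_log_slow q w : (0 < q)%E -> log_slow w ->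
  (tail_norm q w 1%R < +oo)%E ->
  (forall t, 0 < t -> tail_norm q w t \is a fin_num) /\
  log_slow (fun t => fine (tail_norm q w t)).
Proof.
move=> q0 sw fin1.
have T0 t : (0 <= tail_norm q w t)%E by exact: Lq_norm_ge0.
have fin t : 0 < t -> tail_norm q w t \is a fin_num.
  move=> t0; rewrite ge0_fin_numE//; have [t1|/ltW t1] := leP 1 t.
    by apply: le_lt_trans fin1; apply: tail_norm_anti.
  have [A A0 HA] := tail_norm_growth q0 sw (ltr01 : 0 < 1 :> R).
  apply: le_lt_trans (HA _ _ t0 t1) _; rewrite lte_mul_pinfty// lee_fin.
  by rewrite mulr_ge0 ?expR_ge0// ltW.
have [B B0 HB] := le_tail_norm q0 sw.
have pos t : 0 < t -> 0 < fine (tail_norm q w t).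
  move=> t0; have := HB t t0; rewrite -(fineK (fin t t0)) -EFinM lee_fin /=.
  by move=> /(lt_le_trans (sw.1 t t0)); rewrite pmulr_rgt0.
split=> //; apply: log_slow_sub => // e e0.
have [A A0 HA] := tail_norm_growth q0 sw e0.
exists `|ln A| => u t u0 ut; have t0 := lt_le_trans u0 ut.
have := HA u t u0 ut; have := tail_norm_anti q0 sw u0 ut.
rewrite -(fineK (fin t t0)) -(fineK (fin u u0)) -EFinM !lee_fin /=.
have pu := pos u u0; have pt := pos t t0.
rewrite -ler_ln ?posrE// => h1.
rewrite -ler_ln ?posrE ?mulr_gt0 ?expR_gt0// !lnM ?posrE ?mulr_gt0 ?expR_gt0// expRK.
have := ler_norm (ln A) => h2 h3; rewrite ger0_norm ?subr_ge0//; lra.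
Qed.

End log_slow.

(** * The K-functional *)

Section K_functional.
Context (R : realType) (V : lmodType R) (N0 N1 : V -> \bar R).
Hypotheses (N0_ge0 : forall x, (0 <= N0 x)%E) (N1_ge0 : forall x, (0 <= N1 x)%E).
Local Open Scope ereal_scope.

Lemma Kfun_le t f0 f1 : carrier N0 f0 -> carrier N1 f1 ->
  Kfun N0 N1 t (f0 + f1)%R <= N0 f0 + t%:E * N1 f1.
Proof. by move=> c0 c1; apply: ereal_inf_lbound; exists f0, f1. Qed.

Lemma Kfun_ge0 t f : (0 <= t)%R -> 0 <= Kfun N0 N1 t f.
Proof.
move=> t0; apply: le_ereal_inf_tmp => _ [f0 [f1 [_ _ _ ->]]].
by rewrite adde_ge0// mule_ge0// lee_fin.
Qed.

Lemma Kfun_lty t f : sum_space N0 N1 f -> Kfun N0 N1 t f < +oo.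
Proof.
move=> [f0 [f1 [c0 c1 ->]]]; apply: le_lt_trans (Kfun_le t c0 c1) _.
have fin1 : N1 f1 \is a fin_num by rewrite ge0_fin_numE.
by rewrite -(fineK fin1) -EFinM lte_add_pinfty// ltry.
Qed.

Lemma Kfun_fin_num t f : (0 <= t)%R -> sum_space N0 N1 f ->
  Kfun N0 N1 t f \is a fin_num.
Proof. by move=> t0 sf; rewrite ge0_fin_numE ?Kfun_ge0// Kfun_lty. Qed.

Lemma Kfun_lt_decomposition t f d : Kfun N0 N1 t f < d ->
  exists f0 f1, [/\ carrier N0 f0, carrier N1 f1, f = (f0 + f1)%R &
    N0 f0 + t%:E * N1 f1 < d].
Proof.
by move=> /ereal_inf_lt[_ [f0 [f1 [c0 c1 fE ->]]] lt]; exists f0, f1.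
Qed.

Definition Kreal f t : R := fine (Kfun N0 N1 t f).

Lemma Kreal_EFin f t : (0 <= t)%R -> sum_space N0 N1 f ->
  (Kreal f t)%:E = Kfun N0 N1 t f.
Proof. by move=> t0 sf; rewrite fineK// Kfun_fin_num. Qed.

Lemma Kreal_ge0 f t : (0 <= t)%R -> (0 <= Kreal f t)%R.
Proof. by move=> t0; rewrite fine_ge0// Kfun_ge0. Qed.

Lemma le_Kfun f u t : (u <= t)%R -> Kfun N0 N1 u f <= Kfun N0 N1 t f.
Proof.
move=> ut; apply: le_ereal_inf_tmp => _ [f0 [f1 [c0 c1 fE ->]]].
apply: (@le_trans _ _ (N0 f0 + u%:E * N1 f1)); first by rewrite fE Kfun_le.
by rewrite leeD2l// lee_wpmul2r// lee_fin.
Qed.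

Lemma Kfun_sublinear f u t : (0 < u)%R -> (u <= t)%R ->
  Kfun N0 N1 t f <= (t / u)%:E * Kfun N0 N1 u f.
Proof.
move=> u0 ut; have t0 := lt_le_trans u0 ut.
have tu0 : (0 < t / u)%R by rewrite divr_gt0.
rewrite -lee_pdivrMl//; apply: le_ereal_inf_tmp => _ [f0 [f1 [c0 c1 fE ->]]].
rewrite lee_pdivrMl//; apply: (@le_trans _ _ (N0 f0 + t%:E * N1 f1)).
  by rewrite fE Kfun_le.
rewrite ge0_muleDr// ?mule_ge0 ?lee_fin ?(ltW u0)// muleA -EFinM.
rewrite divfK ?gt_eqF// leeD2r// -[leLHS]mul1e lee_wpmul2r// lee_fin.
by rewrite ler_pdivlMr// mul1r.
Qed.

Lemma Kreal_moderate f : sum_space N0 N1 f -> moderate 1 1 (Kreal f).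
Proof.
move=> sf; split=> [t t0|u t u0 t0]; first by rewrite Kreal_ge0// ltW.
have k0 : (0 <= Kreal f t)%R by rewrite Kreal_ge0// ltW.
rewrite !mul1r; have [ut|/ltW tu] := leP u t.
  apply: (@le_trans _ _ (Kreal f t)).
    by rewrite -lee_fin (Kreal_EFin (ltW u0))// (Kreal_EFin (ltW t0))// le_Kfun.
  by rewrite ler_peMl// -expR0 ler_expR.
rewrite ger0_norm ?subr_ge0 ?ler_ln ?posrE// expRB !lnK ?posrE//.
by rewrite -lee_fin EFinM (Kreal_EFin (ltW u0))// (Kreal_EFin (ltW t0))// Kfun_sublinear.
Qed.

Hypothesis N1_quasi : exists2 C : R, (1 <= C)%R &
  forall x y, N1 (x + y)%R <= C%:E * (N1 x + N1 y).

(** The perturbation lies in the second space, so all of it is put into the second term of a nearly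
    optimal decomposition. This compares an element with the first term of any of its
    decompositions, in both directions. *)
Lemma Kfun_add1 : exists2 C : R, (1 <= C)%R & forall f h t, (0 < t)%R ->
  sum_space N0 N1 f -> carrier N1 h ->
  sum_space N0 N1 (f + h)%R /\
  Kfun N0 N1 t (f + h)%R <= C%:E * (Kfun N0 N1 t f + t%:E * N1 h).
Proof.
have [C C1 HC] := N1_quasi; exists C => // f h t t0 sf ch.
have C0 : (0 < C)%R by exact: lt_le_trans C1.
have add f1 : carrier N1 f1 -> carrier N1 (f1 + h)%R.
  move=> c1; rewrite /carrier/=; apply: le_lt_trans (HC _ _) _.
  by rewrite lte_mul_pinfty ?lte_add_pinfty// lee_fin ltW.
split.
  have [f0 [f1 [c0 c1 ->]]] := sf.
  by exists f0, (f1 + h)%R; split=> //; [exact: add|rewrite addrA].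
apply/lee_addgt0Pr => e e0; have eC : (0 < e / C)%R by rewrite divr_gt0.
have : Kfun N0 N1 t f < Kfun N0 N1 t f + (e / C)%:E.
  by rewrite lteDl ?lte_fin// Kfun_fin_num// ltW.
move=> /Kfun_lt_decomposition[f0 [f1 [c0 c1 fE /ltW lt]]].
rewrite {1}fE -addrA; apply: le_trans (Kfun_le t c0 (add _ c1)) _.
apply: (@le_trans _ _ (C%:E * (N0 f0 + t%:E * N1 f1 + t%:E * N1 h))).
  have n1 : 0 <= t%:E * (N1 f1 + N1 h) by rewrite mule_ge0 ?adde_ge0// lee_fin ltW.
  rewrite -addeA -(@ge0_muleDr _ t%:E)// (@ge0_muleDr _ C%:E)//.
  apply: leeD; first by rewrite -[leLHS]mul1e lee_wpmul2r// lee_fin.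
  by rewrite muleCA lee_pmul2l ?lte_fin.
rewrite [X in _ <= _ + X](_ : _ = C%:E * (e / C)%:E); last first.
  by rewrite -EFinM mulrCA divff ?mulr1// gt_eqF.
have finh : t%:E * N1 h \is a fin_num.
  have : N1 h \is a fin_num by rewrite ge0_fin_numE.
  by move=> /fineK <-.
rewrite -ge0_muleDr//; last 2 first.
- by rewrite adde_ge0 ?Kfun_ge0 ?mule_ge0// ?lee_fin// ltW.
- by rewrite lee_fin ltW.
by rewrite lee_pmul2l ?lte_fin// [leRHS]addeAC leeD2r.
Qed.

End K_functional.

(** * Elementary facts on quasi-norms and on products of moderate functions *)

Section quasi_norm_lemmas.
Context (R : realType) (V : lmodType R) (N : V -> \bar R) (HN : quasi_norm N).

Lemma quasi_norm0 : N 0 = 0%E.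
Proof. by rewrite -(scale0r 0) (quasi_normZ HN) normr0 mul0e. Qed.

Lemma quasi_normN x : N (- x) = N x.
Proof. by rewrite -scaleN1r (quasi_normZ HN) normrN1 mul1e. Qed.

End quasi_norm_lemmas.

Section moderate_products.
Context (R : realType).

Lemma moderateM (p C p' C' : R) h h' : 0 <= C -> 0 <= C' ->
  moderate p C h -> moderate p' C' h' ->
  moderate (p + p') (C * C') (fun t => h t * h' t).
Proof.
move=> C0 C'0 [h0 hC] [h'0 h'C]; split=> [t t0|u t u0 t0].
  by rewrite mulr_ge0 ?h0 ?h'0.
rewrite mulrDl expRD (_ : _ * (h t * h' t) =
  (C * expR (p * `|ln u - ln t|) * h t) * (C' * expR (p' * `|ln u - ln t|) * h' t)).
  by apply: ler_pM; rewrite ?h0 ?h'0 ?hC ?h'C.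
by ring.
Qed.

Lemma moderate_powR (s : R) : moderate `|s| 1 (fun t => t `^ s).
Proof.
split=> [t _|u t u0 t0]; first exact: powR_ge0.
rewrite mul1r !powR_expR// -expRD ler_expR -normrM.
by have := ler_norm (s * (ln u - ln t)); lra.
Qed.

End moderate_products.

(** * The two-sided estimate of the K-functional of [(X, A1)] *)

Section endpoint.
Context (R : realType) (V : lmodType R) (A0 A1 : V -> \bar R).
Hypotheses (qA0 : quasi_norm A0) (qA1 : quasi_norm A1).
Variables (theta0 : R) (q0 r0 : \bar R) (a0 b0 : R -> R).
Hypotheses (theta0_gt0 : 0 < theta0) (theta0_lt1 : theta0 < 1).
Hypotheses (q0_gt0 : (0 < q0)%E) (r0_gt0 : (0 < r0)%E).
Hypotheses (sa0 : log_slow a0) (sb0 : log_slow b0).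

Let w s := b0 s / a0 s.
Hypothesis fin1 : (tail_norm r0 w 1%R < +oo)%E.

Let X := interpL_norm A0 A1 theta0 r0 b0 q0 a0.
Let k := Kreal A0 A1.

Definition tail t := fine (tail_norm r0 (fun s => b0 s / a0 s) t).
(** Up to constants, the value of the norm of [X] when [K] is the profile [u |-> min(u, t)], whose
    limit is [t] and whose initial slope is 1. Thus [rho t] is to the couple [(X, A1)] what [t] is
    to [(A0, A1)]. *)
Definition rho t := t `^ (1 - theta0) * (a0 t * tail t).

Let sw : log_slow w. Proof. exact: log_slowM sb0 (log_slowV sa0). Qed.

Let tail_fin t : 0 < t -> tail_norm r0 w t \is a fin_num.
Proof. exact: (tail_norm_log_slow r0_gt0 sw fin1).1. Qed.

Lemma tail_log_slow : log_slow tail.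
Proof. exact: (tail_norm_log_slow r0_gt0 sw fin1).2. Qed.

Let tail_gt0 t : 0 < t -> 0 < tail t. Proof. exact: tail_log_slow.1. Qed.
Let a0_gt0 t : 0 < t -> 0 < a0 t. Proof. exact: sa0.1. Qed.
Let w_gt0 t : 0 < t -> 0 < w t. Proof. exact: sw.1. Qed.

Lemma rho_gt0 t : 0 < t -> 0 < rho t.
Proof. by move=> t0; rewrite !mulr_gt0 ?powR_gt0 ?a0_gt0 ?tail_gt0. Qed.

Lemma ln_rho t : 0 < t -> ln (rho t) = (1 - theta0) * ln t + ln (a0 t * tail t).
Proof.
move=> t0; rewrite /rho lnM ?ln_powR ?posrE ?powR_gt0//.
by rewrite mulr_gt0 ?a0_gt0 ?tail_gt0.
Qed.

Lemma rho_almost_power e : 0 < e -> exists2 C : R, 0 <= C & forall u t, 0 < u -> 0 < t ->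
  `|ln (rho u) - ln (rho t) - (1 - theta0) * (ln u - ln t)| <=
    e * `|ln u - ln t| + C.
Proof.
move=> e0; have [C C0 HC] := (log_slowM sa0 tail_log_slow).2 e e0.
exists C => // u t u0 t0; rewrite !ln_rho//.
by rewrite (_ : _ - _ = ln (a0 u * tail u) - ln (a0 t * tail t)) ?HC//; ring.
Qed.

Let A0_ge0 := quasi_norm_ge0 qA0.
Let A1_ge0 := quasi_norm_ge0 qA1.

Let h g u := u `^ (- theta0) * a0 u * k g u.

Lemma interpL_normE g : sum_space A0 A1 g ->
  X g = Lq_norm r0 `]0%R, +oo[%classic (fun s => ((s `^ (- rinv r0) * w s)%:E *
    Lq_norm q0 `]0%R, s[%classic (fun u => (u `^ (- rinv q0) * h g u)%:E))%E).
Proof.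
move=> sg; rewrite /X /interpL_norm asboolT//; apply: eq_Lq_norm => s _.
congr (_ * _)%E; apply: eq_Lq_norm => u /=; rewrite in_itv/= => /andP[u0 _].
rewrite -Kreal_EFin// ?(ltW u0)// -EFinM; congr EFin.
rewrite /h /k !powR_expR// mulrDl expRD; ring.
Qed.

Lemma interpL_norm_lower : exists2 A : R, 0 < A & forall g t, 0 < t ->
  sum_space A0 A1 g -> ((rho t / t * k g t)%:E <= A%:E * X g)%E.
Proof.
have [C C0 ma] := log_slow_moderate sa0 (ltr01 : 0 < 1 :> R).
pose p := `|- theta0| + 1 + 1.
have p0 : 0 <= p by rewrite !addr_ge0.
have mh g : sum_space A0 A1 g -> moderate p (1 * C * 1) (h g).
  move=> sg; apply: moderateM => //; first by rewrite mul1r ltW.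
    by apply: moderateM => //; [exact: ltW|exact: moderate_powR].
  exact: Kreal_moderate.
have CC0 : 0 < 1 * C * 1 by rewrite mul1r mulr1.
have [A A_gt0 HA] := moderate_le_Lq_norm q0_gt0 p0 CC0.
exists A => // g t t0 sg; have [h0 _] := mh g sg.
(* The first factor will bound the inner norm from below for every [s > t]; the second is the outer
   norm of the remaining weight over []t, +oo[]. *)
have -> : rho t / t * k g t = h g t * tail t.
  have E : t `^ (1 - theta0) = t * t `^ (- theta0).
    by rewrite powRD ?powRr1 ?(ltW t0)// (gt_eqF t0) implybT.
  by rewrite /rho /h E; field; rewrite gt_eqF.
have X0 : (0 <= X g)%E by rewrite /X /interpL_norm asboolT// Lq_norm_ge0.
have /predU1P[<-|ht0] : (0 == h g t) || (0 < h g t) by rewrite -le_eqVlt h0.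
  by rewrite mul0r mule_ge0// lee_fin ltW.
rewrite EFinM /tail fineK ?tail_fin// -lee_pdivlMl// muleA -EFinM.
rewrite interpL_normE//.
have inner s : t < s -> ((h g t)%:E <= A%:E *
    Lq_norm q0 `]0%R, s[%classic (fun u => (u `^ (- rinv q0) * h g u)%:E))%E.
  move=> ts; have e0 := expR_gt0 1 : 0 < expR 1 :> R.
  apply: (HA _ (mh g sg) (t / expR 1)).
  - by rewrite divr_gt0.
  - rewrite (mulrC (expR 1)) divfK ?gt_eqF// lexx andbT ler_pdivrMr// ler_peMr ?ltW//.
    by rewrite expR_gt1.
  - move=> u /=; rewrite !in_itv/= (mulrC (expR 1)) divfK ?gt_eqF// => /andP[tu us].
    by rewrite (lt_trans _ tu) ?divr_gt0// (lt_trans us ts).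
  - by move=> u /=; rewrite in_itv/= => /andP[].
set F := (fun s : R => (_ * Lq_norm q0 _ _)%E).
have F0 s : `]0%R, +oo[%classic s -> (0 <= F s)%E.
  move=> /pos_itvP s0; rewrite /F mule_ge0 ?Lq_norm_ge0// lee_fin.
  by rewrite mulr_ge0 ?powR_ge0// ltW// w_gt0.
have cst0 : 0 < (h g t)^-1 * A by rewrite mulr_gt0 ?invr_gt0.
apply: (@le_trans _ _ (((h g t)^-1 * A)%:E * Lq_norm r0 `]t, +oo[%classic F)%E); last first.
  rewrite lee_pmul2l ?lte_fin//; apply: sub_Lq_norm => //.
  by move=> s /(itv_pos t0) s0; rewrite /= in_itv/= s0.
apply: Lq_norm_leZ => //.
  by apply: weight_ge0 => // s; exact: itv_pos.
move=> s ts; have s0 := itv_pos t0 ts.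
have ws0 : 0 <= s `^ (- rinv r0) * w s by rewrite mulr_ge0 ?powR_ge0// ltW// w_gt0.
rewrite /F muleCA -[leLHS]mule1; apply: lee_wpmul2l; first by rewrite lee_fin.
rewrite EFinM -muleA lee_pdivlMl// mule1; apply: inner.
by move: ts; rewrite /= in_itv/= andbT.
Qed.

(** For the inner norm over []0, s[], [v] will be the smaller of [s] and [t], the point where the
    bound peaks. Left of [v] the weight times [u / rho u] is exactly [1 / tail u]; right of [t] the
    bound on [k g] is constant and the power [- theta0] provides the decay. *)
Let h_pointwise delta : 0 < delta -> exists2 e : R, 0 < e & exists2 B : R, 0 < B &
  forall g D t, 0 < t -> 0 < D ->
    (forall u, 0 < u -> u <= t ->
       k g u <= D * (u / rho u) * expR (- delta * (ln t - ln u))) ->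
    (forall u, t <= u -> k g u <= D * (t / rho t)) ->
    forall u v, 0 < u -> 0 < v -> v <= t -> (u <= v) || (v == t) ->
    h g u <= B * D / tail v * expR (- delta * (ln t - ln v)) *
             expR (- e * `|ln u - ln v|).
Proof.
(* One half of [delta] absorbs the variation of [tail], one half of [theta0] that of [a0]; the other
   halves are the decay that remains on the two sides. *)
move=> delta0; pose e := Num.min (delta / 2) (theta0 / 2).
have d2 : 0 < delta / 2 by rewrite divr_gt0.
have h2 : 0 < theta0 / 2 by rewrite divr_gt0.
have e0 : 0 < e by rewrite /e lt_min d2 h2.
have ed : e <= delta / 2 by rewrite /e ge_min lexx.
have eh : e <= theta0 / 2 by rewrite /e ge_min lexx orbT.
have [C1 C10 HC1] := tail_log_slow.2 _ d2.
have [C2 C20 HC2] := sa0.2 _ h2.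
exists e => //; exists (expR (C1 + C2)); first exact: expR_gt0.
move=> g D t t0 D0 Hle Hge u v u0 v0 vt uv.
have tu := tail_gt0 u0; have tv := tail_gt0 v0; have tt := tail_gt0 t0.
have au := a0_gt0 u0; have at_ := a0_gt0 t0.
have ru := rho_gt0 u0; have rt := rho_gt0 t0.
have Dtv : 0 < D / tail v by rewrite divr_gt0.
have E z : 0 < z -> z `^ (1 - theta0) = z * z `^ (- theta0).
  by move=> z0; rewrite powRD ?powRr1 ?(ltW z0)// (gt_eqF z0) implybT.
have pz z : 0 < z -> z `^ (- theta0) != 0.
  by move=> z0; rewrite gt_eqF// powR_gt0.
have [{}uv|vu] := leP u v.
  have luv : ln u <= ln v by rewrite ler_ln ?posrE.
  have lvt : ln v <= ln t by rewrite ler_ln ?posrE.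
  have E1 : u `^ (- theta0) * a0 u * (u / rho u) = (tail u)^-1.
    by rewrite /rho E//; field; rewrite ?pz ?gt_eqF.
  have E2 : (tail u)^-1 <= expR (C1 + delta / 2 * (ln v - ln u)) * (tail v)^-1.
    rewrite -[in leLHS](lnK tu) -[in leRHS](lnK tv) -!expRN -expRD ler_expR.
    have := HC1 u v u0 v0; rewrite ler_norml distrC ger0_norm ?subr_ge0//.
    by move=> /andP[]; lra.
  apply: (@le_trans _ _ ((tail u)^-1 * (D * expR (- delta * (ln t - ln u))))).
    rewrite -E1 /h (_ : _ * (_ / _) * _ = u `^ (- theta0) * a0 u *
      (D * (u / rho u) * expR (- delta * (ln t - ln u)))); last by ring.
    by rewrite ler_pM2l ?Hle ?(le_trans uv)// mulr_gt0 ?powR_gt0.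
  apply: (@le_trans _ _ (expR (C1 + delta / 2 * (ln v - ln u)) * (tail v)^-1 *
      (D * expR (- delta * (ln t - ln u))))).
    by rewrite ler_wpM2r// mulr_ge0 ?expR_ge0// ltW.
  rewrite [leLHS](_ : _ = D / tail v * (expR (C1 + delta / 2 * (ln v - ln u)) *
     expR (- delta * (ln t - ln u)))); last by ring.
  rewrite [leRHS](_ : _ = D / tail v * (expR (C1 + C2) *
     (expR (- delta * (ln t - ln v)) * expR (- e * `|ln u - ln v|)))); last by ring.
  rewrite ler_pM2l// -!expRD ler_expR distrC ger0_norm ?subr_ge0//.
  nra.
have vE : v = t by move: uv; rewrite leNgt vu /= => /eqP.
rewrite {}vE in v0 vt vu uv tv Dtv *.
have ltu : ln t <= ln u by rewrite ler_ln ?posrE// ltW.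
rewrite subrr mulr0 expR0 mulr1.
apply: (@le_trans _ _ (u `^ (- theta0) * a0 u * (D * (t / rho t)))).
  by rewrite /h ler_pM2l ?Hge ?(ltW vu)// mulr_gt0 ?powR_gt0.
rewrite [leLHS](_ : _ = D / tail t * (u `^ (- theta0) / t `^ (- theta0) * (a0 u / a0 t))); last first.
  by rewrite /rho E//; field; rewrite ?pz ?gt_eqF.
rewrite [leRHS](_ : _ = D / tail t * (expR (C1 + C2) * expR (- e * `|ln u - ln t|))); last by ring.
rewrite ler_pM2l// -(lnK au) -(lnK at_) !powR_expR// -!expRN -!expRD ler_expR.
have := HC2 u t u0 t0; rewrite ler_norml ger0_norm ?subr_ge0// => /andP[_ ?].
nra.
Qed.

(** For [s <= t] the quotient [w s / tail s] is bounded, and the power [delta] makes the outer norm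
    converge. For [s > t] the inner bound is constant in [s], and the outer norm equals the [tail t]
    by which it is divided. *)
Let interpL_norm_le delta : 0 < delta -> exists2 A : R, 0 < A & forall g D t,
    0 < t -> 0 < D -> sum_space A0 A1 g ->
    (forall u, 0 < u -> u <= t ->
       k g u <= D * (u / rho u) * expR (- delta * (ln t - ln u))) ->
    (forall u, t <= u -> k g u <= D * (t / rho t)) ->
    (X g <= (A * D)%:E)%E.
Proof.
move=> delta0; have [e e0 [B B0 HB]] := h_pointwise delta0.
have [Z Z0 HZ] := haar_norm_kernel q0_gt0 e0.
have [Z' Z'0 HZ'] := haar_norm_kernel r0_gt0 delta0.
have [S S0 HS] := Lq_norm_setU r0_gt0.
have [W W0 HW] := le_tail_norm r0_gt0 sw.
exists (S * (B * Z * (W * Z' + 1))); first by rewrite !mulr_gt0// addr_gt0// mulr_gt0.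
move=> g D t t0 D0 sg Hle Hge.
have h0 u : 0 < u -> 0 <= h g u.
  by move=> u0; rewrite /h !mulr_ge0 ?powR_ge0 ?Kreal_ge0 ?(ltW u0) ?(ltW (a0_gt0 u0)).
have inner s v : 0 < s -> 0 < v -> v <= t -> (s <= v) || (v == t) ->
    (Lq_norm q0 `]0%R, s[%classic (fun u => (u `^ (- rinv q0) * h g u)%:E) <=
     (B * D * Z / tail v * expR (- delta * (ln t - ln v)))%:E)%E.
  move=> s0 v0 vt sv; have tv := tail_gt0 v0.
  pose c := B * D / tail v * expR (- delta * (ln t - ln v)).
  have c0 : 0 < c by rewrite !mulr_gt0 ?invr_gt0 ?expR_gt0.
  rewrite (_ : B * D * Z / tail v * _ = c * Z); last by rewrite /c; ring.
  rewrite EFinM; have := HZ (ln v); rewrite -(@lee_pmul2l _ c%:E) ?lte_fin//.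
  apply: le_trans; apply: (@le_trans _ _ (c%:E * Lq_norm q0 `]0%R, s[%classic
      (fun u : R => (u `^ (- rinv q0) * expR (- e * `|ln u - ln v|))%R%:E))%E).
    apply: Lq_norm_leZ => // u; rewrite /= in_itv/= => /andP[u0 us].
      by rewrite lee_fin mulr_ge0 ?powR_ge0 ?h0.
    rewrite -EFinM lee_fin [leRHS]mulrCA ler_wpM2l ?powR_ge0//.
    apply: HB Hle Hge _ _ _ _ _ _ => //.
    by case/orP: sv => [sv|->]; [rewrite (le_trans (ltW us) sv)|rewrite orbT].
  rewrite lee_pmul2l ?lte_fin//; apply: sub_Lq_norm => //.
    by move=> u /=; rewrite !in_itv/= => /andP[->].
  by move=> u _; rewrite lee_fin mulr_ge0 ?powR_ge0 ?expR_ge0.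
rewrite interpL_normE//; set F := (fun s : R => (_ * Lq_norm q0 _ _)%E).
have F0 s : 0 < s -> (0 <= F s)%E.
  move=> s0; rewrite /F mule_ge0 ?Lq_norm_ge0// lee_fin.
  by rewrite mulr_ge0 ?powR_ge0// ltW// w_gt0.
have -> : `]0%R, +oo[%classic = `]0%R, t]%classic `|` `]t, +oo[%classic.
  apply/seteqP; split=> s /=; rewrite !in_itv/= !andbT.
    by move=> s0; case: (leP s t); [left; rewrite s0|right].
  by move=> -[/andP[]//|]; exact: lt_trans.
apply: (@le_trans _ _ _ _ _ (HS _ _ _ _ _ _)) => //.
  move=> s [|] /=; rewrite in_itv/= => /andP[ts _]; apply: F0 => //.
  exact: lt_trans ts.
rewrite -mulrA EFinM lee_pmul2l ?lte_fin//.
have c0 : 0 < B * D * Z by rewrite !mulr_gt0.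
rewrite (_ : B * Z * (W * Z' + 1) * D = B * D * Z * W * Z' + B * D * Z); last by ring.
rewrite EFinD; apply: leeD.
  have cW0 : 0 < B * D * Z * W by rewrite mulr_gt0.
  rewrite EFinM; have := lee_wpmul2l (x := (B * D * Z * W)%:E) _ (HZ' (ln t)).
  rewrite lee_fin => /(_ (ltW cW0)); apply: le_trans; apply: (@le_trans _ _ ((B * D * Z * W)%:E * Lq_norm r0 `]0%R, t]%classic
      (fun u : R => (u `^ (- rinv r0) * expR (- delta * `|ln u - ln t|))%R%:E))%E).
    apply: Lq_norm_leZ => // s; rewrite /= in_itv/= => /andP[s0 st]; first exact: F0.
    have ts := tail_gt0 s0; have ws := w_gt0 s0.
    have := inner s s s0 s0 st; rewrite lexx => /(_ isT).
    have wp : 0 <= s `^ (- rinv r0) * w s by rewrite mulr_ge0 ?powR_ge0// ltW.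
    move=> /(lee_wpmul2l (x := (s `^ (- rinv r0) * w s)%:E)); rewrite lee_fin => /(_ wp).
    rewrite -/(F s); move=> /le_trans; apply; rewrite -!EFinM lee_fin.
    have := HW s s0; rewrite -(fineK (tail_fin s0)) -EFinM lee_fin -/(tail s) => wt.
    have lst : ln s <= ln t by rewrite ler_ln ?posrE.
    rewrite [`|_|]distrC ger0_norm ?subr_ge0//.
    set E := expR _; have E0 : 0 < E by exact: expR_gt0.
    rewrite [leLHS](_ : _ = B * D * Z * s `^ (- rinv r0) * E * (w s / tail s)); last by ring.
    rewrite [leRHS](_ : _ = B * D * Z * s `^ (- rinv r0) * E * W); last by ring.
    apply: ler_wpM2l; last by rewrite ler_pdivrMr.
    by rewrite !mulr_ge0 ?powR_ge0 ?(ltW E0) ?(ltW B0) ?(ltW D0) ?(ltW Z0).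
  rewrite lee_pmul2l ?lte_fin//; apply: sub_Lq_norm => //.
    by move=> u /=; rewrite !in_itv/= => /andP[->].
  by move=> u _; rewrite lee_fin mulr_ge0 ?powR_ge0 ?expR_ge0.
have tt := tail_gt0 t0.
have ct0 : 0 < B * D * Z / tail t by rewrite divr_gt0.
rewrite [leRHS](_ : _ = (B * D * Z / tail t)%:E * tail_norm r0 w t)%E; last first.
  by rewrite -(fineK (tail_fin t0)) -EFinM -/(tail t) divfK// gt_eqF.
apply: Lq_norm_leZ => // s ts; have s0 := itv_pos t0 ts; first exact: F0.
have := inner s t s0 t0 (lexx t); rewrite eqxx orbT subrr mulr0 expR0 mulr1 => /(_ isT).
have wp : 0 <= s `^ (- rinv r0) * w s by rewrite mulr_ge0 ?powR_ge0// ltW// w_gt0.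
move=> /(lee_wpmul2l (x := (s `^ (- rinv r0) * w s)%:E)); rewrite lee_fin => /(_ wp).
by rewrite -/(F s) [leRHS]muleC.
Qed.

(** The K-functional of the first term [f0] is controlled through [f] and [f1] before [t], and by
    the constant [A0 f0] after it. The contribution of [f1] is linear in [u]; [delta < 1 - theta0]
    lets it satisfy the same decaying bound. *)
Lemma interpL_norm_upper delta : 0 < delta -> delta < 1 - theta0 ->
  exists2 A : R, 0 < A & forall f D t, 0 < t -> 0 < D -> sum_space A0 A1 f ->
    (forall u, 0 < u -> u <= t ->
       k f u <= D * (u / rho u) * expR (- delta * (ln t - ln u))) ->
    sum_space X A1 f /\ (Kfun X A1 (rho t) f <= (A * D)%:E)%E.
Proof.
move=> delta0 delta1; have [A A_gt0 HA] := interpL_norm_le delta0.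
have [C C1 HC] := Kfun_add1 A0_ge0 A1_ge0 (quasi_normD qA1).
have C0 : 0 < C by exact: lt_le_trans C1.
(* With this slack [rho u / rho t] is at most [expR C' * expR (- delta * (ln t - ln u))] for
   [u <= t]. *)
have e0 : 0 < 1 - theta0 - delta by rewrite subr_gt0.
have [C' C'0 HC'] := rho_almost_power e0.
(* The first summand serves [u <= t], where [f] and [f1] both contribute; the final 2 serves
   [u >= t]. *)
pose M := C * (1 + 2 * expR C') + 2.
have E'0 : 0 < expR C' by exact: expR_gt0.
have M2 : 2 <= M by rewrite /M lerDr mulr_ge0 ?(ltW C0)// addr_ge0// mulr_ge0// ltW.
have M0 : 0 < M by exact: lt_le_trans M2.
exists (A * M + 2); first by rewrite addr_gt0// mulr_gt0.
move=> f D t t0 D0 sf Hf; have rt := rho_gt0 t0.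
(* The factor 2 makes the bound at [u = t] strict, so that the infimum yields a decomposition. *)
have : (Kfun A0 A1 t f < (2 * (D * (t / rho t)))%:E)%E.
  rewrite -(Kreal_EFin A0_ge0 A1_ge0 (ltW t0) sf) lte_fin.
  have := Hf t t0 (lexx t); rewrite subrr mulr0 expR0 mulr1 => /le_lt_trans; apply.
  by rewrite ltr_pMl ?ltr1n// !mulr_gt0 ?invr_gt0.
move=> /Kfun_lt_decomposition[f0 [f1 [c0 c1 fE lt2]]].
have n0f : A0 f0 \is a fin_num by rewrite ge0_fin_numE.
have n1f : A1 f1 \is a fin_num by rewrite ge0_fin_numE.
move: lt2; rewrite -(fineK n0f) -(fineK n1f) -EFinM -EFinD lte_fin.
set n0 := fine (A0 f0); set n1 := fine (A1 f1) => lt2.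
have n00 : 0 <= n0 by rewrite fine_ge0// A0_ge0.
have n10 : 0 <= n1 by rewrite fine_ge0// A1_ge0.
have tn10 : 0 <= t * n1 by rewrite mulr_ge0// ltW.
have n0_le : n0 <= 2 * (D * (t / rho t)) by lra.
have n1_le : n1 <= 2 * D / rho t.
  rewrite -(ler_pM2l t0) (_ : t * (2 * D / rho t) = 2 * (D * (t / rho t))); last by ring.
  lra.
have c10 : carrier A1 0 by rewrite /carrier/= (quasi_norm0 qA1) ltry.
have sf0 : sum_space A0 A1 f0 by exists f0, 0; rewrite addr0.
have Dtr u : 0 < u -> 0 < D * (u / rho u).
  by move=> u0; rewrite mulr_gt0// divr_gt0// rho_gt0.
have Xf0 : (X f0 <= (A * (M * D))%:E)%E.
  apply: (HA _ _ t) => //; first exact: mulr_gt0.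
    move=> u u0 ut; have ru := rho_gt0 u0.
    have c1N : carrier A1 (- f1) by rewrite /carrier/= (quasi_normN qA1).
    have [_] := HC f (- f1) u u0 sf c1N.
    rewrite fE addrK -fE (quasi_normN qA1) -(fineK n1f) -/n1.
    rewrite -(Kreal_EFin A0_ge0 A1_ge0 (ltW u0) sf0).
    rewrite -(Kreal_EFin A0_ge0 A1_ge0 (ltW u0) sf) -(EFinM u) -EFinD -(EFinM C) lee_fin.
    move=> /le_trans; apply; rewrite -/k.
    set E := expR _; have E0 : 0 < E by exact: expR_gt0.
    have h1 := Hf u u0 ut.
    have lut : ln u <= ln t by rewrite ler_ln ?posrE.
    have h2 : (rho t)^-1 <= expR C' * E * (rho u)^-1.
      rewrite -(lnK rt) -(lnK ru) -!expRN -!expRD ler_expR.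
      have := HC' t u t0 u0; rewrite (ger0_norm (x := ln t - ln u)) ?subr_ge0//.
      rewrite ler_norml => /andP[]; lra.
    have h3 : u * n1 <= 2 * D * u * (expR C' * E * (rho u)^-1).
      apply: (@le_trans _ _ (u * (2 * D / rho t))); first by rewrite ler_wpM2l// ltW.
      rewrite (_ : u * _ = 2 * D * u * (rho t)^-1); last by ring.
      by rewrite ler_wpM2l// !mulr_ge0// ltW.
    have h4 : 0 <= D * (u / rho u) * E by rewrite mulr_ge0 ?ltW// Dtr.
    apply: (@le_trans _ _ (C * (1 + 2 * expR C') * (D * (u / rho u) * E))).
      rewrite -[leRHS]mulrA ler_pM2l// (_ : (1 + _) * _ = D * (u / rho u) * E +
        2 * D * u * (expR C' * E * (rho u)^-1)); last by ring.
      exact: lerD.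
    rewrite [leRHS](_ : _ = M * (D * (u / rho u) * E)); last by rewrite /M; ring.
    by rewrite ler_wpM2r// /M lerDl.
  move=> u tu; have u0 := lt_le_trans t0 tu.
  have := Kfun_le u c0 c10.
  rewrite addr0 (quasi_norm0 qA1) mule0 adde0 -(fineK n0f) -/n0.
  rewrite -(Kreal_EFin A0_ge0 A1_ge0 (ltW u0))// lee_fin => /le_trans; apply.
  apply: le_trans n0_le _; rewrite -mulrA ler_wpM2r// ltW//; exact: Dtr.
have cX : carrier X f0 by rewrite /carrier/=; apply: le_lt_trans Xf0 _; rewrite ltry.
split; first by exists f0, f1.
rewrite fE; apply: le_trans (Kfun_le (rho t) cX c1) _.
rewrite -(fineK n1f) -/n1 -EFinM mulrDl EFinD -mulrA; apply: leeD => //.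
by rewrite lee_fin mulrC -ler_pdivlMr.
Qed.

Lemma interpL_norm_ge0 g : (0 <= X g)%E.
Proof. by rewrite /X /interpL_norm; case: ifP => _; rewrite ?Lq_norm_ge0. Qed.

Lemma sum_space_interpL f : sum_space X A1 f -> sum_space A0 A1 f.
Proof.
move=> [g [h' [cg ch ->]]].
have sg : sum_space A0 A1 g.
  by move: cg; rewrite /carrier/= /X /interpL_norm; case: asboolP.
have [C _ HC] := Kfun_add1 A0_ge0 A1_ge0 (quasi_normD qA1).
by have [] := HC g h' 1 ltr01 sg ch.
Qed.

(** In any decomposition [f = g + h'], the factor [rho t / t] turns [k g t] into a quantity below a
    multiple of [X g], and [t * A1 h'] into [rho t * A1 h'], the second term at parameter
    [rho t]. *)
Lemma Kfun_interpL_lower : exists2 B : R, 0 < B & forall f t, 0 < t ->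
  sum_space X A1 f ->
  ((rho t / t * k f t)%:E <= B%:E * Kfun X A1 (rho t) f)%E.
Proof.
have [A A_gt0 HA] := interpL_norm_lower.
have [C C1 HC] := Kfun_add1 A0_ge0 A1_ge0 (quasi_normD qA1).
have C0 : 0 < C by exact: lt_le_trans C1.
have B0 : 0 < C * (A + 1) by rewrite mulr_gt0// addr_gt0.
exists (C * (A + 1)) => // f t t0 sf; have rt := rho_gt0 t0.
rewrite -lee_pdivrMl//; apply: le_ereal_inf_tmp => _ [g [h' [cg ch fE ->]]].
rewrite lee_pdivrMl//.
have sg : sum_space A0 A1 g.
  by move: cg; rewrite /carrier/= /X /interpL_norm; case: asboolP.
have Xg : X g \is a fin_num by rewrite ge0_fin_numE// interpL_norm_ge0.
have nh : A1 h' \is a fin_num by rewrite ge0_fin_numE.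
have [sgh] := HC g h' t t0 sg ch; rewrite -fE in sgh *.
rewrite -(fineK nh) -(fineK Xg); set n := fine (A1 h'); set m := fine (X g).
have m0 : 0 <= m by rewrite fine_ge0// interpL_norm_ge0.
have n0 : 0 <= n by rewrite fine_ge0// A1_ge0.
have := HA g t t0 sg; rewrite -(fineK Xg) -/m -EFinM lee_fin => h1.
rewrite -(Kreal_EFin A0_ge0 A1_ge0 (ltW t0) sg).
rewrite -(Kreal_EFin A0_ge0 A1_ge0 (ltW t0) sgh) -(EFinM t) -EFinD -(EFinM C).
rewrite -(EFinM (rho t)) -EFinD -EFinM !lee_fin -/k => h2.
have rt0 : 0 < rho t / t by rewrite divr_gt0.
apply: (@le_trans _ _ (rho t / t * (C * (k g t + t * n)))); first by rewrite ler_pM2l.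
rewrite (_ : rho t / t * _ = C * (rho t / t * k g t + rho t * n)); last first.
  by field; rewrite gt_eqF.
rewrite -[leRHS]mulrA ler_pM2l//.
have : 0 <= rho t * n by rewrite mulr_ge0// ltW.
nra.
Qed.

End endpoint.

(** * Preparations for the change of variable *)

Section change_of_variable.
Context (R : realType).

(** A discrete intermediate value theorem. In place of continuity, [g] rises by at most [M'] over a
    unit step, so the step that first passes [c] starts within [M'] of it. *)
Lemma quasi_surjective (g : R -> R) (kap M M' : R) : 0 < kap ->
  (forall x y, x <= y -> kap * (y - x) - M <= g y - g x) ->
  (forall x, g (x + 1) <= g x + M') ->
  forall c, exists x, `|g x - c| <= M'.
Proof.
move=> kap0 ginc gstep c.
have arch (z : R) : exists n : nat, z < kap * n%:R.
  exists (Num.bound (`|z| / kap)); rewrite mulrC -ltr_pdivrMr//.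
  apply: le_lt_trans (archi_boundP _); last by rewrite divr_ge0// ltW.
  by rewrite ler_pM2r ?invr_gt0// ler_norm.
have [N HN] := arch (g 0 + M - c).
have gN : g (- N%:R) <= c.
  have := ginc (- N%:R) 0; rewrite oppr_le0 ler0n sub0r opprK => /(_ isT); lra.
have exm : exists m : nat, c < g (- N%:R + m%:R).
  have [m Hm] := arch (c - g (- N%:R) + M); exists m.
  have := ginc (- N%:R) (- N%:R + m%:R); rewrite lerDl ler0n => /(_ isT).
  rewrite addrAC subrr add0r; lra.
case: (ex_minnP exm) => -[|m] cm mmin.
  by move: cm; rewrite addr0 ltNge gN.
exists (- N%:R + m%:R).
have gm : g (- N%:R + m%:R) <= c.
  by rewrite leNgt; apply/negP => /mmin; rewrite ltnn.
have := gstep (- N%:R + m%:R); rewrite -addrA natr1 => h.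
rewrite distrC ger0_norm ?subr_ge0//; lra.
Qed.

Lemma ln_moderate (b : R -> R) p C : (forall t, 0 < t -> 0 < b t) ->
  (forall u t, 0 < u -> 0 < t -> `|ln (b u) - ln (b t)| <= p * `|ln u - ln t| + C) ->
  moderate p (expR C) b.
Proof.
move=> b0 H; split=> [t t0|u t u0 t0]; first exact/ltW/b0.
rewrite -[leLHS](lnK (b0 u u0)) -[X in _ * X](lnK (b0 t t0)) -!expRD ler_expR.
have := ler_norm (ln (b u) - ln (b t)); have := H u t u0 t0; lra.
Qed.

Lemma moderate_le p C p' C' (h : R -> R) : 0 <= C -> p <= p' -> C <= C' ->
  moderate p C h -> moderate p' C' h.
Proof.
move=> C0 pp CC [h0 hC]; split=> // u t u0 t0.
apply: le_trans (hC u t u0 t0) _; apply: ler_wpM2r; first exact: h0.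
by apply: ler_pM; rewrite ?expR_ge0// ler_expR ler_wpM2r.
Qed.

Lemma interp_normE (V : lmodType R) (N0 N1 : V -> \bar R) theta q b f :
  (forall x, (0 <= N0 x)%E) -> (forall x, (0 <= N1 x)%E) -> sum_space N0 N1 f ->
  interp_norm N0 N1 theta q b f =
  haar_norm q (fun t => t `^ (- theta) * b t * Kreal N0 N1 f t).
Proof.
move=> N0_ge0 N1_ge0 sf; rewrite /interp_norm asboolT//; apply: eq_Lq_norm => t.
move=> /pos_itvP t0; rewrite -(Kreal_EFin N0_ge0 N1_ge0 (ltW t0) sf) -EFinM.
by congr EFin; rewrite !powR_expR// mulrDl expRD; ring.
Qed.

End change_of_variable.

(** * The two embeddings *)

Section reiteration.
Context (R : realType) (V : lmodType R) (A0 A1 : V -> \bar R).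
Hypotheses (qA0 : quasi_norm A0) (qA1 : quasi_norm A1).
Variables (theta0 theta : R) (q0 r0 r : \bar R) (a a0 b0 : R -> R).
Hypotheses (theta0_gt0 : 0 < theta0) (theta0_lt1 : theta0 < 1).
Hypotheses (theta_gt0 : 0 < theta) (theta_le1 : theta <= 1).
Hypotheses (q0_gt0 : (0 < q0)%E) (r0_gt0 : (0 < r0)%E) (r_gt0 : (0 < r)%E).
Hypotheses (sa : log_slow a) (sa0 : log_slow a0) (sb0 : log_slow b0).
Hypothesis fin1 : (tail_norm r0 (fun s => (b0 s / a0 s)%R) 1%R < +oo)%E.

Local Notation X := (interpL_norm A0 A1 theta0 r0 b0 q0 a0).
Local Notation rho := (rho theta0 r0 a0 b0).

Let c0 t := a0 t * tail r0 a0 b0 t.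
Let eta := (1 - theta) * theta0 + theta.
Let asharp t := c0 t `^ (1 - theta) * a (rho t).
(** The weight of the space over [(X, A1)], pulled back along [rho]. Below, [x f] and [F f] are the
    integrands of the two spaces with respect to du/u. *)
Let w t := rho t `^ (- theta) * a (rho t).

Let x f t := t `^ (- eta) * asharp t * Kreal A0 A1 f t.
Let F f v := v `^ (- theta) * a v * Kreal X A1 f v.

Let A0_ge0 := quasi_norm_ge0 qA0.
Let A1_ge0 := quasi_norm_ge0 qA1.
Let X_ge0 : forall g, (0 <= X g)%E := interpL_norm_ge0 A0 A1 theta0 q0 r0 a0 b0.
Let rho_gt0 t : 0 < t -> 0 < rho t.
Proof. exact: rho_gt0. Qed.
Let a_gt0 t : 0 < t -> 0 < a t. Proof. exact: sa.1. Qed.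
Let sc0 : log_slow c0.
Proof. exact: log_slowM sa0 (tail_log_slow r0_gt0 sa0 sb0 fin1). Qed.
Let c0_gt0 t : 0 < t -> 0 < c0 t. Proof. exact: sc0.1. Qed.
(** Taken as the slack around the exponent [1 - theta0] of [rho], it leaves [ln rho] with slopes
    between [kap] and [3 * kap] in [ln t], up to an additive constant. *)
Let kap := (1 - theta0) / 2.
Let kap_gt0 : 0 < kap. Proof. by rewrite divr_gt0// subr_gt0. Qed.

Let ln_rho_itv : exists2 C : R, 0 <= C & forall u t, 0 < u -> 0 < t -> u <= t ->
  kap * (ln t - ln u) - C <= ln (rho t) - ln (rho u) <=
  3 * kap * (ln t - ln u) + C.
Proof.
have [C C0 HC] := rho_almost_power theta0 r0_gt0 sa0 sb0 fin1 kap_gt0.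
exists C => // u t u0 t0 ut; have := HC t u t0 u0.
have lut : 0 <= ln t - ln u by rewrite subr_ge0 ler_ln ?posrE.
rewrite (ger0_norm lut) ler_norml /kap => /andP[h1 h2]; apply/andP; split; lra.
Qed.

Let ln_rho_lip : exists2 C : R, 0 <= C & forall u t, 0 < u -> 0 < t ->
  kap * `|ln u - ln t| - C <= `|ln (rho u) - ln (rho t)| <=
  3 * kap * `|ln u - ln t| + C.
Proof.
have [C C0 HC] := ln_rho_itv; exists C => // u t u0 t0.
have K u' t' : 0 < u' -> 0 < t' -> u' <= t' ->
    kap * `|ln u' - ln t'| - C <= `|ln (rho u') - ln (rho t')| <=
    3 * kap * `|ln u' - ln t'| + C.
  move=> u'0 t'0 ut; have /andP[h1 h2] := HC u' t' u'0 t'0 ut.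
  have lut : 0 <= ln t' - ln u' by rewrite subr_ge0 ler_ln ?posrE.
  rewrite [`|ln u' - _|]distrC [`|ln (rho u') - _|]distrC (ger0_norm lut).
  apply/andP; split; first by apply: le_trans h1 (ler_norm _).
  rewrite ler_norml h2 andbT.
  have : 0 <= kap * (ln t' - ln u') by rewrite mulr_ge0// ltW.
  lra.
have [ut|/ltW tu] := leP u t; first exact: K.
by rewrite [`|ln u - _|]distrC [`|ln (rho u) - _|]distrC; exact: K.
Qed.

(** [psi] is a quasi-inverse of [rho] with values on the logarithmic scale. The upper Lipschitz
    bound of [ln rho] becomes the separation that the Schur test asks of [psi]. *)
Let rho_inverse : exists (psi : R -> R) (M c : R), [/\ 0 <= M, 0 <= c,
  forall v, `|ln (rho (expR (psi v))) - ln v| <= M &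
  forall v v', (3 * kap)^-1 * `|ln v - ln v'| - c <= `|psi v - psi v'|].
Proof.
have [C C0 HC] := ln_rho_itv; have [C' C'0 HC'] := ln_rho_lip.
pose g s := ln (rho (expR s)); pose M := 3 * kap + C.
have M0 : 0 <= M by rewrite addr_ge0// mulr_ge0// ltW.
have ginc y z : y <= z -> kap * (z - y) - C <= g z - g y.
  move=> yz; have := HC (expR y) (expR z) (expR_gt0 _) (expR_gt0 _).
  by rewrite ler_expR !expRK => /(_ yz)/andP[].
have gstep y : g (y + 1) <= g y + M.
  have := HC (expR y) (expR (y + 1)) (expR_gt0 _) (expR_gt0 _).
  by rewrite ler_expR !expRK lerDl => /(_ ler01)/andP[_]; rewrite /g /M; lra.
have [psi Hpsi] := choice (fun v => quasi_surjective kap_gt0 ginc gstep (ln v)).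
have k30 : 0 < 3 * kap by rewrite mulr_gt0.
exists psi, M, ((3 * kap)^-1 * (2 * M + C')); split=> //.
  by rewrite mulr_ge0 ?invr_ge0 ?(ltW k30)// addr_ge0// mulr_ge0.
move=> v v'; rewrite -mulrBr ler_pdivrMl//.
have /andP[_] := HC' (expR (psi v)) (expR (psi v')) (expR_gt0 _) (expR_gt0 _).
rewrite !expRK => h; have := Hpsi v; have := Hpsi v'; rewrite -/(g _) => h1 h2.
have : `|ln v - ln v'| <= `|g (psi v) - ln v| + `|g (psi v) - g (psi v')|
    + `|g (psi v') - ln v'|.
  rewrite [`|g (psi v) - ln v|]distrC.
  rewrite (_ : ln v - ln v' = (ln v - g (psi v)) + (g (psi v) - g (psi v')) +
     (g (psi v') - ln v')); last by ring.
  by apply: le_trans (ler_normD _ _) _; rewrite lerD2r ler_normD.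
rewrite /g in h1 h2 *; lra.
Qed.

Let xE f t : 0 < t -> x f t = w t * (rho t / t * Kreal A0 A1 f t).
Proof.
move=> t0; rewrite /x [RHS]mulrA; congr (_ * _); rewrite /asharp /w.
have rt := rho_gt0 t0; have ct := c0_gt0 t0; have at_ := a_gt0 rt.
have pos : 0 < rho t / t by rewrite divr_gt0.
rewrite -(lnK at_) !powR_expR// -[X in _ = _ * X](lnK pos) -!expRD; congr expR.
by rewrite ln_div ?posrE// ln_rho// -/(c0 t) /eta; ring.
Qed.

Let w_gt0 t : 0 < t -> 0 < w t.
Proof. by move=> t0; rewrite mulr_gt0 ?powR_gt0 ?a_gt0 ?rho_gt0. Qed.

(** [w] decays at least like the power [- theta * kap / 2], that is [- 2 * lam]. One [lam] pays for
    the growth allowed in the domination; the other is the [delta] of the upper estimate. *)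
Let lam := theta * kap / 4.

Let lam_gt0 : 0 < lam. Proof. by rewrite divr_gt0// mulr_gt0. Qed.

Let ln_w_decay : exists2 C : R, 0 <= C & forall u t, 0 < u -> 0 < t -> u <= t ->
  ln (w t) - ln (w u) <= - (2 * lam) * (ln t - ln u) + C.
Proof.
have [C C0 HC] := ln_rho_itv.
have th2 : 0 < theta / 2 by rewrite divr_gt0.
have [C' C'0 HC'] := sa.2 _ th2.
exists (2 * theta * C + C') => [|u t u0 t0 ut].
  by rewrite addr_ge0// !mulr_ge0// ltW.
have ru := rho_gt0 u0; have rt := rho_gt0 t0.
rewrite /w !lnM ?posrE ?powR_gt0 ?a_gt0// !ln_powR.
have /andP[h1 h2] := HC u t u0 t0 ut.
have h3 := le_trans (ler_norm _) (HC' (rho t) (rho u) rt ru).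
set d := ln (rho t) - ln (rho u) in h1 h2 h3 *.
(* [rho] increases only up to a bounded factor, so [d] may be negative, but not below [- C]. *)
have h4 : `|d| <= d + 2 * C.
  rewrite ler_norml; apply/andP; split; last lra.
  have : 0 <= kap * (ln t - ln u) by rewrite mulr_ge0 ?(ltW kap_gt0)// subr_ge0 ler_ln ?posrE.
  lra.
have h5 : theta / 2 * `|d| <= theta / 2 * (d + 2 * C) by rewrite ler_pM2l.
have h6 : theta / 2 * (kap * (ln t - ln u) - C) <= theta / 2 * d by rewrite ler_pM2l.
have h7 : 0 <= theta * C by rewrite mulr_ge0// ltW.
have -> : - theta * ln (rho t) + ln (a (rho t)) - (- theta * ln (rho u) + ln (a (rho u)))
  = - theta * d + (ln (a (rho t)) - ln (a (rho u))) by rewrite /d; ring.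
rewrite (_ : - (2 * lam) * (ln t - ln u) = - (theta / 2 * (kap * (ln t - ln u)))); last first.
  by rewrite /lam; field.
lra.
Qed.

Let Kfun_upper : exists2 B : R, 0 < B & forall f, sum_space A0 A1 f ->
  forall s D, 0 < D ->
  (forall u, 0 < u -> x f u <= D * expR (lam * `|s - ln u|)) ->
  sum_space X A1 f /\
  (Kfun X A1 (rho (expR s)) f <= (B * (D / w (expR s)))%:E)%E.
Proof.
have lam1 : lam < 1 - theta0.
  have : theta * kap <= kap by rewrite ger_pMl.
  have := kap_gt0; rewrite /lam /kap; lra.
have [A A_gt0 HA] := interpL_norm_upper qA0 qA1 theta0_gt0 q0_gt0 r0_gt0 sa0 sb0
  fin1 lam_gt0 lam1.
have [C C0 HC] := ln_w_decay.
exists (A * expR C) => [|f sf s D D0 xD]; first by rewrite mulr_gt0// expR_gt0.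
set t := expR s; have t0 : 0 < t by exact: expR_gt0.
have wt := w_gt0 t0.
rewrite (_ : A * expR C * (D / w t) = A * (D * expR C / w t)); last by ring.
apply: HA => //; first by rewrite divr_gt0// mulr_gt0// expR_gt0.
move=> u u0 ut; have wu := w_gt0 u0; have ru := rho_gt0 u0.
have lut : ln u <= ln t by rewrite ler_ln ?posrE.
have := xD u u0; rewrite xE// -{1}(expRK s) -/t ger0_norm ?subr_ge0//.
rewrite -ler_pdivlMl// -ler_pdivlMl ?divr_gt0// => /le_trans; apply.
rewrite invf_div [leLHS](_ : _ = D * (u / rho u) * (expR (lam * (ln t - ln u)) * (w u)^-1));
  last by ring.
rewrite [leRHS](_ : _ = D * (u / rho u) * (expR C / w t * expR (- lam * (ln t - ln u))));
  last by ring.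
apply: ler_wpM2l; first by rewrite mulr_ge0 ?divr_ge0// ltW.
rewrite -(lnK wt) -(lnK wu) -!expRN -!expRD ler_expR.
have := HC u t u0 t0 ut; lra.
Qed.

(** One pair of constants serves all [f], as a uniform embedding constant requires. The variation of
    [a] at [rho t] is controlled in [t] through the Lipschitz bound of [ln rho]. *)
Let moderate_xF : exists p C : R, [/\ 0 <= p, 0 < C,
  (forall f, sum_space A0 A1 f -> moderate p C (x f)) &
  (forall f, sum_space X A1 f -> moderate p C (F f))].
Proof.
have [Ca Ca0 HCa] := log_slow_moderate sa ltr01.
have [C1 C10 HC1] := sc0.2 _ ltr01; have [C2 C20 HC2] := sa.2 _ ltr01.
have [C3 C30 HC3] := ln_rho_lip.
have th1 : 0 <= 1 - theta by rewrite subr_ge0.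
pose p1 := 1 - theta + 3 * kap; pose D1 := (1 - theta) * C1 + C3 + C2.
have mas : moderate p1 (expR D1) asharp.
  have as0 t : 0 < t -> 0 < asharp t.
    by move=> t0; rewrite /asharp mulr_gt0 ?powR_gt0 ?a_gt0 ?rho_gt0 ?c0_gt0.
  apply: ln_moderate => // u t u0 t0; rewrite /asharp.
  rewrite !lnM ?posrE ?powR_gt0 ?a_gt0 ?rho_gt0 ?c0_gt0// !ln_powR.
  have /andP[_ h3] := HC3 u t u0 t0.
  have h1 := HC1 u t u0 t0; have h2 := HC2 _ _ (rho_gt0 u0) (rho_gt0 t0).
  rewrite (_ : _ - _ = (1 - theta) * (ln (c0 u) - ln (c0 t)) +
    (ln (a (rho u)) - ln (a (rho t)))); last by ring.
  apply: le_trans (ler_normD _ _) _; rewrite normrM (ger0_norm th1).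
  have : (1 - theta) * `|ln (c0 u) - ln (c0 t)| <= (1 - theta) * (1 * `|ln u - ln t| + C1).
    by rewrite ler_wpM2l.
  rewrite /p1 /D1; lra.
have kap0 := ltW kap_gt0.
pose px := `|- eta| + p1 + 1; pose Cx := 1 * expR D1 * 1.
pose pF := `|- theta| + 1 + 1; pose CF := 1 * Ca * 1.
have p10 : 0 <= p1 by rewrite addr_ge0// mulr_ge0.
have px0 : 0 <= px by rewrite addr_ge0// addr_ge0.
have pF0 : 0 <= pF by rewrite !addr_ge0.
have Cx0 : 0 < Cx by rewrite /Cx mul1r mulr1 expR_gt0.
have CF0 : 0 < CF by rewrite /CF mul1r mulr1.
exists (px + pF), (Cx + CF); split=> [||f sf|f sf].
- exact: addr_ge0.
- exact: addr_gt0.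
- apply: (@moderate_le _ px Cx); rewrite ?(ltW Cx0) ?lerDl ?(ltW CF0)//.
  have e0 : 0 <= expR D1 by exact: expR_ge0.
  have mw := moderateM ler01 e0 (moderate_powR (- eta)) mas.
  by apply: (moderateM _ ler01 mw (Kreal_moderate _ _ sf)); rewrite ?mul1r.
- apply: (@moderate_le _ pF CF); rewrite ?(ltW CF0) ?lerDr ?(ltW Cx0)//.
  have mw := moderateM ler01 (ltW Ca0) (moderate_powR (- theta)) HCa.
  by apply: (moderateM _ ler01 mw (Kreal_moderate _ _ sf)); rewrite ?mul1r ?(ltW Ca0).
Qed.

Lemma reiteration_sub_interp : embedded (interp_norm X A1 theta r a)
                                      (interp_norm A0 A1 eta r asharp).
Proof.
have [p [C [p0 C0 mx mF]]] := moderate_xF.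
have [c c_ge0 Hc] := ln_rho_lip.
have [B B0 HB] := Kfun_interpL_lower qA0 qA1 theta0 q0_gt0 r0_gt0 sa0 sb0 fin1.
(* The Schur test has a single constant for moderateness and domination, hence the sum. *)
have CB0 : 0 < C + B by rewrite addr_gt0.
have CC : C <= C + B by rewrite lerDl ltW.
(* The rate 1 is arbitrary: with [psi = ln o rho], the domination is evaluated only at [u = rho v],
   where the exponential is 1. *)
have [A A_gt0 HA] := haar_norm_schur r_gt0 ltr01 kap_gt0 c_ge0 p0 CB0.
have key f : carrier (interp_norm X A1 theta r a) f ->
    (interp_norm A0 A1 eta r asharp f <= A%:E * interp_norm X A1 theta r a f)%E.
  rewrite /carrier/=; have [sf _|nsf] := pselect (sum_space X A1 f); last first.
    by rewrite /interp_norm asboolF.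
  have sf' := sum_space_interpL qA0 qA1 sf.
  rewrite !interp_normE//; apply: (HA (F f) (x f) (fun t => ln (rho t))).
  - exact: moderate_le (ltW C0) (lexx p) CC (mF f sf).
  - exact: moderate_le (ltW C0) (lexx p) CC (mx f sf').
  - by move=> v v' v0 v'0; have /andP[] := Hc v v' v0 v'0.
  move=> v v0 D D0 FD; have rv := rho_gt0 v0.
  have := FD _ rv; rewrite subrr normr0 mulr0 expR0 mulr1 => FvD.
  have := HB f v v0 sf.
  rewrite -(Kreal_EFin X_ge0 A1_ge0 (ltW rv) sf) -EFinM lee_fin => h.
  apply: (@le_trans _ _ (B * F f (rho v))).
    rewrite xE// /F -/(w v) [leRHS]mulrCA; apply: ler_wpM2l => //.
    exact/ltW/w_gt0.
  have Fv0 : 0 <= F f (rho v) by exact: (mF f sf).1.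
  by apply: ler_pM => //; [exact: ltW|rewrite lerDr ltW].
split; last by exists A.
move=> f cf; apply: le_lt_trans (key f cf) _.
by rewrite lte_mul_pinfty// lee_fin ltW.
Qed.

Lemma interp_sub_reiteration : embedded (interp_norm A0 A1 eta r asharp)
                                       (interp_norm X A1 theta r a).
Proof.
have [p [C [p0 C0 mx mF]]] := moderate_xF.
have [psi [M [c [M0 c_ge0 psiM psic]]]] := rho_inverse.
have [B B0 HB] := Kfun_upper.
have k3 : 0 < (3 * kap)^-1 by rewrite invr_gt0 mulr_gt0.
pose C' := C * expR (p * M) * B.
have C'0 : 0 < C' by rewrite !mulr_gt0 ?expR_gt0.
have CC0 : 0 < C + C' by exact: addr_gt0.
have CC : C <= C + C' by rewrite lerDl ltW.
have [A A_gt0 HA] := haar_norm_schur r_gt0 lam_gt0 k3 c_ge0 p0 CC0.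
have [A' A'_gt0 HA'] := moderate_le_haar_norm r_gt0 p0 C0.
have key f : carrier (interp_norm A0 A1 eta r asharp) f ->
    (interp_norm X A1 theta r a f <= A%:E * interp_norm A0 A1 eta r asharp f)%E.
  rewrite /carrier/=; have [sf|nsf] := pselect (sum_space A0 A1 f); last first.
    by rewrite /interp_norm asboolF.
  rewrite interp_normE// -/(x f) => fin.
  have sf' : sum_space X A1 f.
    have N0 : (0 <= haar_norm r (x f))%E by exact: Lq_norm_ge0.
    have Nfin : haar_norm r (x f) \is a fin_num by rewrite ge0_fin_numE.
    set n := fine (haar_norm r (x f)).
    have n0 : 0 <= n by rewrite fine_ge0.
    have D0 : 0 < A' * n + 1 by rewrite ltr_wpDl// mulr_ge0// ltW.
    (* Finiteness of the norm bounds [x f] pointwise, so the upper estimate at any one point, here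
       [s = 0], puts [f] into [X + A1]. The 1 in [D] keeps it positive. *)
    apply: (HB f sf 0 _ D0 _).1 => u u0.
    have := HA' _ (mx f sf) u u0; rewrite -(fineK Nfin) -/n -EFinM lee_fin => h.
    apply: (@le_trans _ _ (A' * n + 1)); first by rewrite (le_trans h)// lerDl.
    by rewrite ler_peMr ?(ltW D0)// -expR0 ler_expR mulr_ge0// ltW.
  rewrite interp_normE// -/(F f); apply: (HA (x f) (F f) psi).
  - exact: moderate_le (ltW C0) (lexx p) CC (mx f sf).
  - exact: moderate_le (ltW C0) (lexx p) CC (mF f sf').
  - by move=> v v' _ _; exact: psic.
  move=> v v0 D D0 xD; set t := expR (psi v).
  have t0 : 0 < t by exact: expR_gt0.
  have rt := rho_gt0 t0; have wt := w_gt0 t0.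
  have [_] := HB f sf (psi v) D D0 xD; rewrite -/t.
  rewrite -(Kreal_EFin X_ge0 A1_ge0 (ltW rt) sf') lee_fin => hK.
  have hF : F f (rho t) <= B * D.
    rewrite /F -/(w t) (_ : B * D = w t * (B * (D / w t))).
      by rewrite ler_pM2l.
    by field; rewrite gt_eqF.
  (* [rho t] meets [v] only within a factor [expR M]; moderateness of [F f] covers the difference,
     hence [expR (p * M)] in [C']. *)
  apply: le_trans ((mF f sf').2 v (rho t) v0 rt) _.
  apply: (@le_trans _ _ (C * expR (p * M) * (B * D))).
    apply: ler_pM => //.
    - by rewrite mulr_ge0 ?expR_ge0// ltW.
    - exact: (mF f sf').1.
    - by rewrite ler_pM2l// ler_expR ler_wpM2l// distrC psiM.
  by rewrite mulrA ler_wpM2r ?(ltW D0)// /C' lerDr ltW.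
split; last by exists A.
move=> f cf; apply: le_lt_trans (key f cf) _.
by rewrite lte_mul_pinfty// lee_fin ltW.
Qed.

End reiteration.

Theorem theorem13 (R : realType) (V : topologicalLmodType R)
    (A0 A1 : V -> \bar R)
    (hA : compatible_couple A0 A1)
    (hA01 : exists f : V, [/\ carrier A0 f, carrier A1 f & f <> 0])
    (theta0 theta : R) (q0 r0 r : \bar R) (a a0 b0 : R -> R)
    (htheta0 : 0 < theta0 < 1) (htheta : 0 < theta <= 1)
    (hq0 : (0 < q0)%E) (hr0 : (0 < r0)%E) (hr : (0 < r)%E)
    (ha : slowly_varying a) (ha0 : slowly_varying a0)
    (hb0 : slowly_varying b0)
    (hfin : (Lq_norm r0 `]1%R, +oo[
               (fun s => (s `^ (- rinv r0) * (b0 s / a0 s))%:E) < +oo)%E)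
    (hfin1 : theta = 1 ->
             (Lq_norm r `]0%R, 1%R[
               (fun s => (s `^ (- rinv r) * a s)%:E) < +oo)%E) :
  let c0 := fun t : R =>
    a0 t * fine (Lq_norm r0 `]t, +oo[
                   (fun s => (s `^ (- rinv r0) * (b0 s / a0 s))%:E)) in
  let rho := fun t : R => t `^ (1 - theta0) * c0 t in
  let eta := (1 - theta) * theta0 + theta in
  let asharp := fun t : R => c0 t `^ (1 - theta) * a (rho t) in
  isomorphic_spaces
    (interp_norm (interpL_norm A0 A1 theta0 r0 b0 q0 a0) A1 theta r a)
    (interp_norm A0 A1 eta r asharp).
Proof.
move=> c0 rho eta asharp.
have [/andP[theta0_gt0 theta0_lt1] /andP[theta_gt0 theta_le1]] := (htheta0, htheta).
have qA0 : quasi_norm A0 := (couple_Banach0 hA).1.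
have qA1 : quasi_norm A1 := (couple_Banach1 hA).1.
have sa := slowly_varying_log_slow ha.
have sa0 := slowly_varying_log_slow ha0.
have sb0 := slowly_varying_log_slow hb0.
split.
- exact: (reiteration_sub_interp qA0 qA1 theta0_lt1 theta_le1
    hq0 hr0 hr sa sa0 sb0 hfin).
- exact: (interp_sub_reiteration qA0 qA1 theta0_gt0 theta0_lt1 theta_gt0 theta_le1
    hq0 hr0 hr sa sa0 sb0 hfin).
Qed.
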